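(* Let $f(x)=g(x)\,I[0\le x\le 1]$ be a probability density, where $g:\mathbb{R}\to\mathbb{R}$ is periodic with period one, is bounded away from zero, and has a bounded fourth derivative. Let $r_n\in(0,1/2]$ with $r_n=o(1)$, let $A$ be the adjacency matrix of the random geometric graph $\mathcal{G}_n(f,r_n)$ with underlying i.i.d. points $X_1,\dots,X_n$ of density $f$, and let $\mu_n=\frac{\mathbb{E}[A_{12}A_{13}A_{23}]}{\mathbb{E}[A_{12}A_{13}]}$. Then \begin{align*} \mathbb{E}[A_{12}\mid X_1]&=2r_nf(X_1)+\frac{f''(X_1)}{3}r_n^3+O(r_n^5),\\ \mathbb{E}[A_{12}A_{13}\mid X_1]&=4r_n^2f^2(X_1)+\frac{4r_n^4}{3}f(X_1)f''(X_1)+O(r_n^6),\\ \mathbb{E}[A_{12}A_{23}\mid X_1]&=4r_n^2f^2(X_1)+\frac{r_n^4}{3}\big[4(f'(X_1))^2+6f(X_1)f''(X_1)\big]+O(r_n^6),\\ \mathbb{E}[A_{12}A_{13}A_{23}\mid X_1]&=3r_n^2f^2(X_1)+\frac{5r_n^4}{12}\big[(f'(X_1))^2+2f(X_1)f''(X_1)\big]+O(r_n^5),\\ \mathbb{E}[A_{12}A_{13}]&=4r_n^2\,\mathbb{E}[f^2(X_1)]+\frac{4r_n^4}{3}\mathbb{E}[f(X_1)f''(X_1)]+O(r_n^5),\\ \mathbb{E}[A_{12}A_{13}A_{23}]&=3r_n^2\,\mathbb{E}[f^2(X_1)]+\frac{5r_n^4}{12}\mathbb{E}\big[(f'(X_1))^2+2f(X_1)f''(X_1)\big]+O(r_n^6),\\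 \mu_n&=\frac{3+r_n^2a_f}{4+r_n^2b_f}+O(r_n^3), \end{align*} where the remainder terms $O(r_n^3)$, $O(r_n^5)$, $O(r_n^6)$ do not depend on $X_1$ (i.e. the bounds are uniform in $X_1\in[0,1]$), and $$a_f=\frac{5\,\mathbb{E}[(f'(X_1))^2+2f(X_1)f''(X_1)]}{12\,\mathbb{E}[f^2(X_1)]},\qquad b_f=\frac{4\,\mathbb{E}[f(X_1)f''(X_1)]}{3\,\mathbb{E}[f^2(X_1)]}.$$
   Context: Random geometric graph $\mathcal{G}_n(f,r_n)$: given a probability density $f$ on $[0,1]$ (fixed, not depending on $n$) and a radius $r_n$, let $X_1,\dots,X_n$ be independent with density $f$. The graph on vertices $\{1,\dots,n\}$ has adjacency matrix $A_{ij}=I[d(X_i,X_j)\le r_n]$ for $i\ne j$, and $A_{ii}=0$, where $d(x,y)=\min\{|x-y|,1-|x-y|\}$. $I[E]$ is the indicator of $E$. All asymptotics are as $n\to\infty$; $a_n=O(b_n)$ means $|a_n|/b_n$ is bounded by a constant, and $a_n=o(b_n)$ means $a_n/b_n\to0$. ''Bounded away from zero'' means $g(x)\ge c$ for all $x$ and some constant $c>0$. On $[0,1]$ the derivatives $f',f''$ are those of $g$ (one-sided at the endpoints). Expectations such as $\mathbb{E}[f^2(X_1)]$ are with respect to $X_1\sim f$, so $\mathbb{E}[f^2(X_1)]=\int_0^1 f^3(x)\,dx$. *)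

(* Defs.v *)
From HB Require Import structures.
From mathcomp Require Export all_boot all_order all_algebra.
From mathcomp Require Export all_classical all_reals all_analysis.
Export Order.TTheory GRing.Theory Num.Theory.
Export numFieldNormedType.Exports.

Set Implicit Arguments.
Unset Strict Implicit.
Unset Printing Implicit Defensive.

Local Open Scope ring_scope.
Local Open Scope classical_set_scope.

Definition circle_dist (R : realType) (x y : R) : R :=
  Num.min `|x - y| (1 - `|x - y|).

Definition rgg_adj (R : realType) (n : nat) (r : R) (x : 'I_n -> R) : 'M[R]_n :=
  \matrix_(i < n, j < n)
    (if (i != j) && (circle_dist (x i) (x j) <= r) then 1 else 0).

(* The vertices called 1, 2 and 3 in the mathematical text. *)
Definition vtx1 (n : nat) (hn : (2 < n)%N) : 'I_n := Ordinal (ltnW (ltnW hn)).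
Definition vtx2 (n : nat) (hn : (2 < n)%N) : 'I_n := Ordinal (ltnW hn).
Definition vtx3 (n : nat) (hn : (2 < n)%N) : 'I_n := Ordinal hn.

Definition on_unit_interval (R : realType) (g : R -> R) : R -> R :=
  fun x => g x * \1_(`[0, 1] : set R) x.

Definition is_density (R : realType) (f : R -> R) : Prop :=
  [/\ measurable_fun setT f, forall x, 0 <= f x &
      (\int[@lebesgue_measure R]_x (f x)%:E = 1)%E].

Definition has_density (d : measure_display) (T : measurableType d)
    (R : realType) (P : probability T R) (X : {RV P >-> R}) (f : R -> R) : Prop :=
  forall B : set R, measurable B ->
    distribution P X B = (\int[@lebesgue_measure R]_(x in B) (f x)%:E)%E.

(* For a finite family, the product rule over all of 'I_n contains the one over
   every subfamily: take the other B i to be setT. *)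
Definition mutually_independent (d : measure_display) (T : measurableType d)
    (R : realType) (P : probability T R) (n : nat)
    (X : 'I_n -> {RV P >-> R}) : Prop :=
  forall B : 'I_n -> set R, (forall i, measurable (B i)) ->
    (P (\bigcap_(i in [set: 'I_n]) (X i @^-1` B i)) =
     \prod_(i < n) P (X i @^-1` B i))%E.

(* Z is a version of E[Y | X], conditional expectation on the sigma-algebra
   {X @^-1` B | B Borel} generated by X. *)
Definition is_cond_exp (d : measure_display) (T : measurableType d)
    (R : realType) (P : probability T R) (X : {RV P >-> R}) (Y Z : T -> R) : Prop :=
  let sigmaX : set (set T) := preimage_set_system setT X measurable in
  [/\ forall B : set R, measurable B -> sigmaX (Z @^-1` B),
      P.-integrable setT (EFin \o Z) &
      forall D, sigmaX D ->
        (\int[P]_(w in D) (Z w)%:E = \int[P]_(w in D) (Y w)%:E)%E].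

Definition expect (d : measure_display) (T : measurableType d)
    (R : realType) (P : probability T R) (Y : T -> R) : R := fine ('E_P[Y])%E.

Definition bounded_fourth_derivative (R : realType) (g : R -> R) : Prop :=
  (forall (k : nat) (x : R), (k < 4)%N -> derivable (g^`(k)) x 1) /\
  exists M : R, forall x : R, `|g^`(4) x| <= M.

(* Main.v *)
Require Import Defs.
From mathcomp Require Import ring lra measurable_realfun.

(** The point X1 = x being given, the other points are integrated out against
    the density, and each statistic becomes a deterministic function of x and
    r: a polynomial in r with coefficients in the derivatives of g at x, up to
    a uniform error.

    - Probability. By uniqueness of product measures the law of
      (X1, (X2, X3)) is a product, so that a bounded statistic
      phi (X1, (X2, X3)) and its conditional mean H (X1), where
      H x = E phi (x, (X2, X3)), have the same integral over every event
      X1 \in B ([integral_cond_mean_preimage]).  Two integrable functions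
      measurable for the sigma-algebra of X1 with the same integrals over such
      events agree almost surely ([cond_exp_ae_unique]).  Hence an estimate
      of H that is uniform on [0, 1] bounds every version of the conditional
      expectation, and, after integration, the expectations.

    - Unfolding. On [0, 1] the condition that x and y are at distance at most
      r on the circle is expressed by a 1-periodic kernel in x - y.  As g is
      periodic, an integral over [0, 1] against this kernel is an integral
      over [x - r, x + r] ([integral_circ_ker]).  This turns H into one of

        S x      = \int_(|v| <= r) g (x + v)              for A12,
        S x ^ 2                                           for A12 A13,
        \int_(|u| <= r) g (x + u) S (x + u)               for A12 A23,
        \int\int_(|u|, |v|, |u - v| <= r) g (x + u) g (x + v)
                                                          for A12 A13 A23,

      the last one when r < 1/3; for r >= 1/3 both sides of the expansion are
      bounded and r ^ 6 is bounded below, so that a larger constant suffices.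

    - Expansion. The bound on the fourth derivative gives
      |g (x + w) - T w| <= M w ^ 4 for the cubic Taylor polynomial T at x
      ([taylor_bound]).  Replacing g by T costs O(r ^ 5), resp. O(r ^ 6); the
      integrals of the polynomials are computed exactly.  The regions are
      symmetric, so the odd moments vanish and the expansions skip every
      other power of r ([window_expansion], [sliding_expansion],
      [hexagon_expansion], collected in [conditional_expansions]).

    - Ratio. E[A12 A13] is bounded below by a multiple of r ^ 2, because g is
      bounded away from zero; the quotient of the two expansions is then
      controlled for small r ([ratio_approx]), hence for all but finitely many
      n, and the remaining n are absorbed in the constant. *)

Set Implicit Arguments.
Unset Strict Implicit.
Unset Printing Implicit Defensive.

Local Open Scope ring_scope.
Local Open Scope classical_set_scope.

(** * Densities and translations *)

Section density.
Local Open Scope ereal_scope.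
Context d (T : measurableType d) (R : realType).
Variables (nu mu : {measure set T -> \bar R}) (w : T -> R).
Hypothesis mw : measurable_fun setT w.
Hypothesis w0 : forall x, (0 <= w x)%R.
Hypothesis nuE : forall B, measurable B -> nu B = \int[mu]_(x in B) (w x)%:E.

Import HBNNSimple.

Let integral_density_indic E : measurable E ->
  \int[nu]_x (\1_E x)%:E = \int[mu]_x ((w x)%:E * (\1_E x)%:E).
Proof.
move=> mE; rewrite integral_indic// setIT nuE// integral_mkcond.
apply: eq_integral => x _; rewrite patchE indicE.
by case: (x \in E); rewrite ?mule1 ?mule0.
Qed.

Let integral_density_nnsfun (f : {nnsfun T >-> R}) :
  \int[nu]_x (f x)%:E = \int[mu]_x ((w x)%:E * (f x)%:E).
Proof.
under [LHS]eq_integral do rewrite fimfunE -fsumEFin//.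
rewrite [LHS]ge0_integral_fsum//; last 2 first.
  - by move=> r; exact/measurable_EFinP/measurableT_comp.
  - by move=> n x _; rewrite EFinM nnfun_muleindic_ge0.
under [RHS]eq_integral.
  move=> x xD; rewrite fimfunE -fsumEFin// ge0_mule_fsumr; last first.
    by move=> r; rewrite EFinM nnfun_muleindic_ge0.
  over.
rewrite [RHS]ge0_integral_fsum//; last 2 first.
  - move=> r; apply: emeasurable_funM; first exact/measurable_EFinP.
    by apply/measurable_EFinP/measurableT_comp.
  - move=> n x _; apply: mule_ge0; first by rewrite lee_fin.
    by rewrite EFinM nnfun_muleindic_ge0.
apply: eq_fsbigr => r rf.
have r0 : (0 <= r)%R.
  by move: rf; rewrite inE => -[x _ <-]; exact: fun_ge0.
under eq_integral do rewrite EFinM.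
under [RHS]eq_integral do rewrite EFinM muleCA.
rewrite !ge0_integralZl//.
- by rewrite integral_density_indic.
- apply: emeasurable_funM; first exact/measurable_EFinP.
  by apply/measurable_EFinP/measurable_indic.
- by move=> x _; rewrite mule_ge0 ?lee_fin.
- by apply/measurable_EFinP/measurable_indic.
Qed.

(** Integration against a measure with density w, for non-negative functions. *)
Lemma integral_density (f : T -> \bar R) :
  measurable_fun setT f -> (forall x, 0 <= f x) ->
  \int[nu]_x f x = \int[mu]_x ((w x)%:E * f x).
Proof.
move=> mf f0.
pose f_ := nnsfun_approx measurableT mf.
transitivity (lim (\int[nu]_x (f_ n x)%:E @[n --> \oo])).
  rewrite -monotone_convergence//=.
  - apply: eq_integral => ? /[!inE] xD; apply/esym/cvg_lim => //=.
    exact: cvg_nnsfun_approx.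
  - by move=> n; exact/measurable_EFinP/measurable_funTS.
  - by move=> n ? _; rewrite lee_fin.
  - by move=> ? _ ? ? mn; rewrite lee_fin; exact/lefP/nd_nnsfun_approx.
transitivity (lim (\int[mu]_x ((w x)%:E * (f_ n x)%:E) @[n --> \oo])).
  by apply: congr_lim; apply/funext => n /=; exact: integral_density_nnsfun.
rewrite -monotone_convergence//=.
- apply: eq_integral => x _; apply/cvg_lim => //=.
  by apply: cvgeZl => //; exact: cvg_nnsfun_approx.
- move=> n; apply: emeasurable_funM; first exact/measurable_EFinP.
  exact/measurable_EFinP.
- by move=> n ? _; rewrite mule_ge0 ?lee_fin.
- move=> x _ m n mn; rewrite lee_wpmul2l ?lee_fin//.
  exact/lefP/nd_nnsfun_approx.
Qed.

End density.

Section translation.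
Local Open Scope ereal_scope.
Context (R : realType).
Local Notation mu := (@lebesgue_measure R).

Lemma lebesgue_measure_shift (c : R) (A : set R) : measurable A ->
  pushforward mu (fun x : measurableTypeR R => (x + c)%R : measurableTypeR R) A
  = mu A.
Proof.
move=> mA.
have ms : measurable_fun setT
  (fun x : measurableTypeR R => (x + c)%R : measurableTypeR R).
  by apply: measurable_funD => //; exact: measurable_cst.
apply/esym.
apply: (@lebesgue_measure_unique _
  (@pushforward _ _ _ _ R mu _) _ A mA).
move=> _ [[a b]] _ <-.
rewrite /pushforward /=.
rewrite [X in _ = mu X](_ : _ = `](a - c)%R, (b - c)%R]%classic); last first.
  by apply/seteqP; split => x /=; rewrite !in_itv/= ltrBlDr lerBrDr.
rewrite !lebesgue_measure_itv/= !lte_fin ltrD2r.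
by case: ifP => // _; rewrite -!EFinB; congr (_%:E); lra.
Qed.

Lemma ge0_integral_shift (c : R) (D : set R) (f : R -> \bar R) :
  measurable D -> measurable_fun D f -> (forall x, D x -> 0 <= f x) ->
  \int[mu]_(x in D) f x =
  \int[mu]_(x in (fun x => x + c)%R @^-1` D) f (x + c)%R.
Proof.
move=> mD mf f0.
have ms : measurable_fun setT
  (fun x : measurableTypeR R => (x + c)%R : measurableTypeR R).
  by apply: measurable_funD => //; exact: measurable_cst.
rewrite -(@ge0_integral_pushforward _ _ _ _ R _ ms mu)//; last first.
  by move=> x /[!inE]; exact: f0.
by apply: eq_measure_integral => //= A mA AS; exact/esym/lebesgue_measure_shift.
Qed.

End translation.

(** * Periodic functions and the kernel of the circle *)

Section periodic_integral.
Local Open Scope ereal_scope.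
Context (R : realType).
Local Notation mu := (@lebesgue_measure R).

(** The integral of a 1-periodic function over a period does not depend on the
    origin; the statement for nearby origins is enough here. *)
Lemma ge0_integral_period (f : R -> \bar R) (a b : R) :
  measurable_fun setT f -> (forall x, 0 <= f x) ->
  (forall x, f (x + 1)%R = f x) -> (a <= b <= a + 1)%R ->
  \int[mu]_(x in `[a, (a + 1)%R[) f x = \int[mu]_(x in `[b, (b + 1)%R[) f x.
Proof.
move=> mf f0 fper /andP[ab ba1].
have -> : `[a, (a + 1)%R[%classic = `[a, b[ `|` `[b, (a + 1)%R[ :> set R.
  by rewrite -itv_bndbnd_setU ?bnd_simp.
have -> : `[b, (b + 1)%R[%classic = `[b, (a + 1)%R[ `|` `[(a + 1)%R, (b + 1)%R[
    :> set R.
  by rewrite -itv_bndbnd_setU ?bnd_simp// lerD2r.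
have mfS D : measurable_fun D f by exact: measurable_funTS.
have disj (u v w : R) : [disjoint `[u, v[ & `[v, w[]%classic.
  apply/disj_setPS => x /=; rewrite !in_itv/= => -[/andP[_ h] /andP[h' _]].
  by move: (lt_le_trans h h'); rewrite ltxx.
rewrite !ge0_integral_setU//=; [|exact: mfS|exact: mfS].
rewrite addeC; congr (_ + _).
rewrite [RHS](@ge0_integral_shift _ 1)//=.
rewrite [X in _ = integral _ X _](_ : _ = `[a, b[%classic); last first.
  by apply/seteqP; split => x /=; rewrite !in_itv/= ltrD2r lerD2r.
by apply: eq_integral => x _; rewrite fper.
Qed.

End periodic_integral.

Section circular_kernel.
Context (R : realType).
Implicit Types (r t x y : R).
Local Notation mu := (@lebesgue_measure R).

(** The 1-periodic indicator of the points at distance at most r from an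
    integer. *)
Definition circ_ker r t : R :=
  \1_(\bigcup_(k in [set: int]) `[k%:~R - r, k%:~R + r]) t.

Lemma circ_kerP r t :
  circ_ker r t = (`[< exists k : int, `|t - k%:~R| <= r >])%:R.
Proof.
rewrite /circ_ker indicE; congr (nat_of_bool _)%:R.
apply/idP/asboolP; rewrite inE /=.
  by move=> [k _ /=]; rewrite in_itv/= => h; exists k; rewrite ler_distl.
by move=> [k]; rewrite ler_distl => h; exists k => //=; rewrite in_itv.
Qed.

Lemma circ_ker_ge0 r t : 0 <= circ_ker r t.
Proof. by rewrite /circ_ker indicE. Qed.

Lemma circ_ker_le1 r t : circ_ker r t <= 1.
Proof. by rewrite /circ_ker indicE lern1 leq_b1. Qed.

Lemma measurable_circ_ker r : measurable_fun setT (circ_ker r).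
Proof.
apply: measurable_indic.
rewrite bigcup_set_type; apply: countable_bigcupT_measurable => //.
exact: countableP.
Qed.

Lemma circ_kerD1 r t : circ_ker r (t + 1) = circ_ker r t.
Proof.
rewrite !circ_kerP; congr (nat_of_bool _)%:R; apply: asbool_equiv_eq.
split=> -[k hk]; [exists (k - 1)|exists (k + 1)].
  by apply: le_trans hk; rewrite intrB [_ - _ :> R](_ : _ = t + 1 - k%:~R)//; ring.
by apply: le_trans hk; rewrite intrD [_ - _ :> R](_ : _ = t - k%:~R)//; ring.
Qed.

(** On [-1, 1] the kernel only sees the integers -1, 0 and 1. *)
Lemma circ_ker_dist r t : 0 < r -> r <= 2^-1 -> `|t| <= 1 ->
  circ_ker r t = (Num.min `|t| (1 - `|t|) <= r)%R%:R.
Proof.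
move=> r0 r2 t1; rewrite circ_kerP; congr (nat_of_bool _)%:R.
rewrite ge_min; apply/asboolP/orP.
  move=> [k hk].
  move: t1 hk; rewrite ler_norml ler_distl => /andP[t1 t2] /andP[h1 h2].
  have [k2|k2] := leP 2 k.
    by have : (2 <= k%:~R :> R) by [rewrite (_ : 2 = 2%:~R)// ler_int]; lra.
  have [k3|k3] := leP k (-2).
    have : (k%:~R <= - 2%:~R :> R) by rewrite -intrN ler_int.
    by move=> ?; lra.
  have : k \in [:: -1; 0; 1] by case: k k2 k3 {h1 h2} => [[|[|[]]]|[|[]]].
  rewrite !inE => /or3P[] /eqP kE; subst k.
  - right; move: h1 h2; rewrite (_ : (-1)%:~R = -1 :> R)// => h1 h2.
    have ? : t <= 0 by lra.
    rewrite ler0_norm//; lra.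
  - by left; rewrite ler_norml; apply/andP; split; lra.
  - right; have ? : 0 <= t by lra.
    rewrite ger0_norm//; lra.
move=> [h|h]; first by exists 0; rewrite subr0.
move: h; case: (lerP 0 t) => t0 h.
  exists 1; rewrite ler_distl; move: t1 h; rewrite ger0_norm// => t1 h.
  by apply/andP; split; lra.
exists (-1); rewrite (_ : (-1)%:~R = -1 :> R)// ler_distl.
move: t1 h; rewrite ltr0_norm// => t1 h.
by apply/andP; split; lra.
Qed.

(** The distance [circle_dist] is not periodic, but on [0, 1] it is governed by
    the periodic kernel. *)
Lemma circle_dist_ker r x y : 0 < r -> r <= 2^-1 ->
  0 <= x <= 1 -> 0 <= y <= 1 ->
  (circle_dist x y <= r)%R%:R = circ_ker r (x - y).
Proof.
move=> r0 r2 /andP[x0 x1] /andP[y0 y1].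
by rewrite circ_ker_dist// ler_norml; apply/andP; split; lra.
Qed.

(** Away from the other integers, the kernel is the indicator of [-r, r]. *)
Lemma circ_ker_near r t : 0 < r -> r <= 2^-1 -> `|t| < 1 - r ->
  circ_ker r t = (`|t| <= r)%R%:R.
Proof.
move=> r0 r2 tr; rewrite circ_ker_dist//; last lra.
rewrite ge_min [X in _ || X](_ : _ = false) ?orbF//.
apply/negbTE; rewrite -ltNge; lra.
Qed.

(** Shift the domain of integration to the period centred at x, where the kernel
    is the indicator of [x - r, x + r]. *)
Lemma integral_circ_ker (q : R -> \bar R) r x : 0 < r -> r <= 2^-1 ->
  0 <= x <= 1 -> measurable_fun setT q -> (forall y, 0 <= q y)%E ->
  (forall y, q (y + 1) = q y) ->
  (\int[mu]_(y in `[0%R, 1%R]) (q y * (circ_ker r (x - y))%:E) =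
   \int[mu]_(u in `[(- r)%R, r]) q (x + u)%R)%E.
Proof.
move=> r0 r2 /andP[x0 x1] mq q0 qper.
pose F y := (q y * (circ_ker r (x - y))%:E)%E.
have mF : measurable_fun setT F.
  apply: emeasurable_funM => //; apply/measurable_EFinP.
  apply: measurableT_comp (measurable_circ_ker r) _.
  exact: measurable_funB.
have F0 y : (0 <= F y)%E by rewrite mule_ge0 ?lee_fin ?circ_ker_ge0.
have Fper y : F (y + 1) = F y.
  by rewrite /F qper (_ : x - y = x - (y + 1) + 1) ?circ_kerD1//; ring.
have mFS D : measurable_fun D F by exact: measurable_funTS.
transitivity (\int[mu]_(y in `[0%R, (0 + 1)%R[) F y)%E.
  by rewrite add0r integral_itv_bndo_bndc.
transitivity (\int[mu]_(y in `[(x - 2^-1)%R, (x - 2^-1 + 1)%R[) F y)%E.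
  have [xh|xh] := leP (x - 2^-1) 0.
    by apply/esym/ge0_integral_period => //; apply/andP; split; lra.
  by apply: ge0_integral_period => //; apply/andP; split; lra.
rewrite (_ : x - 2^-1 + 1 = x + 2^-1); last by lra.
rewrite integral_itv_bndo_bndc//.
transitivity (\int[mu]_(y in `[(x - r)%R, (x + r)%R]) q y)%E.
  rewrite integral_mkcond [RHS]integral_mkcond; apply: eq_integral => y _.
  rewrite !patchE !mem_setE !in_itv/= /F.
  case: ifPn => [/andP[y1 y2]|].
    rewrite circ_ker_dist//; last by rewrite ler_norml; apply/andP; split; lra.
    have -> : (Num.min `|x - y| (1 - `|x - y|) <= r) = (x - r <= y <= x + r).
      rewrite -ler_distlC distrC min_l//.
      have : `|y - x| <= 2^-1 by rewrite ler_distl; apply/andP; split.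
      lra.
    by case: ifP; rewrite ?mule1 ?mule0.
  move=> h; case: ifPn => // h'; exfalso; move/negP: h; apply.
  by move/andP: h' => [? ?]; apply/andP; split; lra.
rewrite (@ge0_integral_shift _ x)//=; last exact: measurable_funTS.
rewrite [X in integral _ X](_ : _ = `[- r, r]%classic); last first.
  by apply/seteqP; split => y /=; rewrite !in_itv/=; lra.
by apply: eq_integral => y _; rewrite addrC.
Qed.

End circular_kernel.

(** * Taylor expansions and approximate integration *)

Section taylor.
Context (R : realType).
Implicit Types (g : R -> R).

(** Taylor polynomial of g at x, of degree less than n, in the increment. *)
Definition taylor_poly n g x : {poly R} :=
  \poly_(k < n) (derive1n k g x / k`!%:R).

Lemma derive1n_derive1 n g : (derive1 g)^`(n) = g^`(n.+1).
Proof. by rewrite /derive1n iterSr. Qed.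

Lemma deriv_taylor_poly n g x :
  deriv (taylor_poly n.+1 g x) = taylor_poly n (derive1 g) x.
Proof.
apply/polyP => i; rewrite coef_deriv !coef_poly ltnS.
case: ifP => _; last by rewrite mul0rn.
rewrite derive1n_derive1 factS [X in _ / X]natrM -mulr_natr.
by field; rewrite [1 + _]addrC natr1 !pnatr_eq0 -lt0n fact_gt0.
Qed.

Lemma MVT_bound (h dh : R -> R) (w B : R) :
  (forall u : R, is_derive u 1 h (dh u)) -> (forall u, `|u| <= `|w| -> `|dh u| <= B) ->
  `|h w - h 0| <= B * `|w|.
Proof.
move=> hd hB.
have hc (i : interval R) : {within [set` i], continuous h}.
  by apply: derivable_within_continuous => u _; have [] := hd u.
have [w0|w0] := leP 0 w.
  have [c cw ->] := MVT_segment w0 (fun u _ => hd u) (hc _).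
  rewrite subr0 normrM ler_wpM2r//; apply: hB.
  by move: cw; rewrite in_itv/= => /andP[c0 cw]; rewrite !ger0_norm.
have [c cw e] := MVT_segment (ltW w0) (fun u _ => hd u) (hc _).
rewrite distrC e sub0r normrM normrN ler_wpM2r//; apply: hB.
by move: cw; rewrite in_itv/= => /andP[c0 cw]; rewrite !ler0_norm// ?lerN2// ltW.
Qed.

(** The constant M / n! is not needed: bounding each derivative of the remainder
    by the mean value theorem gives M. *)
Lemma taylor_bound n g M x w :
  (forall k y, (k < n)%N -> derivable g^`(k) y 1) ->
  (forall y, `|g^`(n) y| <= M) ->
  `|g (x + w) - (taylor_poly n g x).[w]| <= M * `|w| ^+ n.
Proof.
elim: n g w => [|n IH] g w gd gM.
  rewrite /taylor_poly poly_def big_ord0 horner0 subr0 expr0 mulr1.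
  exact: gM.
pose h u := g (x + u) - (taylor_poly n.+1 g x).[u].
have hd (u : R) : is_derive u 1 h (derive1 g (x + u) - (taylor_poly n (derive1 g) x).[u]).
  apply: is_deriveB; last first.
    rewrite -deriv_taylor_poly; exact: is_derive_poly.
  have gx : is_derive (x + u) 1 g (derive1 g (x + u)).
    by rewrite derive1E; apply: derivableP; exact: (gd 0%N).
  have sx : is_derive u (1 : R) (fun u : R => x + u) (0 + 1).
    by apply: is_deriveD.
  by have := is_derive1_comp gx sx; rewrite add0r mulr1.
have -> : g (x + w) - (taylor_poly n.+1 g x).[w] = h w - h 0.
  rewrite /h addr0 horner_coef0 coef_poly/= fact0 divr1.
  by rewrite subrr subr0.
rewrite exprSr mulrA; apply: (MVT_bound hd) => u uw.
apply: le_trans (_ : M * `|u| ^+ n <= _).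
  apply: IH; last by move=> y; rewrite derive1n_derive1.
  by move=> k y kn; rewrite derive1n_derive1; exact: gd.
rewrite ler_wpM2l//; last by rewrite lerXn2r// nnegrE.
by apply: le_trans (gM 0).
Qed.

End taylor.

Section ereal_approximation.
Context (R : realType).
Implicit Types (e : \bar R) (q K : R).
Local Notation mu := (@lebesgue_measure R).

(** The extended real e is finite and within K of q.  Non-negative integrals are
    thus estimated without a separate proof that they are finite. *)
Definition approx_within e q K := ((q - K)%:E <= e <= (q + K)%:E)%E.

Lemma approx_withinE (s q K : R) : approx_within s%:E q K = (`|s - q| <= K).
Proof. by rewrite /approx_within !lee_fin ler_distl. Qed.

Lemma approx_withinP e q K :
  approx_within e q K -> exists2 s, e = s%:E & `|s - q| <= K.
Proof.
case: e => [s||]; last 2 first.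
- by rewrite /approx_within => /andP[].
- by rewrite /approx_within => /andP[].
by rewrite approx_withinE; exists s.
Qed.

Lemma approx_withinW e q q' K K' : approx_within e q K ->
  `|q - q'| + K <= K' -> approx_within e q' K'.
Proof.
move=> /approx_withinP[s -> hs] h; rewrite approx_withinE.
rewrite (_ : s - q' = (s - q) + (q - q')); last by ring.
by apply: le_trans (ler_normD _ _) _; lra.
Qed.

(** Only the approximate value q1 of the first factor and the second factor
    itself need to be bounded. *)
Lemma approx_withinM e1 e2 q1 q2 K1 K2 B1 B2 :
  approx_within e1 q1 K1 -> approx_within e2 q2 K2 ->
  `|q1| <= B1 -> approx_within e2 0 B2 ->
  approx_within (e1 * e2) (q1 * q2) (B2 * K1 + B1 * K2).
Proof.
move=> /approx_withinP[s1 -> h1] /approx_withinP[s2 -> h2] hq.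
rewrite -EFinM !approx_withinE subr0 => hs.
rewrite (_ : _ - _ = s2 * (s1 - q1) + q1 * (s2 - q2)); last by ring.
apply: le_trans (ler_normD _ _) _; rewrite !normrM.
by apply: lerD; apply: ler_pM.
Qed.

Lemma approx_withinD e1 e2 q1 q2 K1 K2 :
  approx_within e1 q1 K1 -> approx_within e2 q2 K2 ->
  approx_within (e1 + e2) (q1 + q2) (K1 + K2).
Proof.
move=> /approx_withinP[s1 -> h1] /approx_withinP[s2 -> h2].
rewrite -EFinD !approx_withinE.
rewrite (_ : _ - _ = (s1 - q1) + (s2 - q2)); last by ring.
by apply: le_trans (ler_normD _ _) _; apply: lerD.
Qed.

Lemma integral_poly (P : {poly R}) a b : a <= b ->
  (\int[mu]_(u in `[a, b]) ((deriv P).[u])%:E = (P.[b] - P.[a])%:E)%E.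
Proof.
rewrite le_eqVlt => /predU1P[->|ab].
  by rewrite subrr set_itv1 integral_set1.
rewrite EFinB; apply: continuous_FTC2 => //.
- by apply: continuous_subspaceT; exact: continuous_horner.
- split => [u _||]; first exact: derivable_horner.
  + by apply: cvg_at_right_filter; exact: continuous_horner.
  + by apply: cvg_at_left_filter; exact: continuous_horner.
- by move=> u _; rewrite -derivE.
Qed.

Lemma integrable_poly (P : {poly R}) a b :
  mu.-integrable `[a, b] (fun u => (P.[u])%:E).
Proof.
apply: continuous_compact_integrable; first exact: segment_compact.
by apply: continuous_subspaceT; exact: continuous_horner.
Qed.

(** Integrating an approximation by a polynomial, given as the derivative of P. *)
Lemma approx_within_integral (phi : R -> \bar R) (P : {poly R}) (a b K : R) :
  a <= b -> measurable_fun `[a, b] phi ->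
  (forall u, a <= u <= b -> approx_within (phi u) (deriv P).[u] K) ->
  approx_within (\int[mu]_(u in `[a, b]) phi u)%E (P.[b] - P.[a]) (K * (b - a)).
Proof.
move=> ab mphi h.
have derK (k : R) : deriv (P + k *: 'X) = deriv P + k%:P.
  by rewrite derivD derivZ derivX alg_polyC.
have eK (k : R) : (P.[b] - P.[a] + k * (b - a))%:E =
    (\int[mu]_(u in `[a, b]) ((deriv P + k%:P).[u])%:E)%E.
  by rewrite -derK integral_poly// !hornerE; congr _%:E; ring.
have iphi : mu.-integrable `[a, b] phi.
  pose B := deriv P * deriv P + 1 + `|K|%:P.
  apply: (le_integrable _ _ _ (integrable_poly B a b)) => //.
    move=> u; rewrite /= in_itv/= => /h /approx_withinP[s -> hs].
    rewrite /= lee_fin.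
    apply: le_trans (_ : `|(deriv P).[u]| + `|K| <= _).
      have := ler_norm K; have := ler_normD (s - (deriv P).[u]) (deriv P).[u].
      by rewrite subrK; lra.
    apply: le_trans (ler_norm _); rewrite /B !hornerE lerD2r.
    by rewrite -expr2 -real_normK ?num_real//; nra.

rewrite /approx_within -mulNr !eK; apply/andP; split.
  apply: le_integral => //; first exact: integrable_poly.
  move=> u; rewrite inE /= in_itv/= => /h /andP[+ _].
  by rewrite !hornerE.
apply: le_integral => //; first exact: integrable_poly.
move=> u; rewrite inE /= in_itv/= => /h /andP[_].
by rewrite !hornerE.
Qed.

Lemma approx_within_integral_cst (phi : R -> \bar R) (a b B : R) :
  a <= b -> measurable_fun `[a, b] phi ->
  (forall u, a <= u <= b -> approx_within (phi u) 0 B) ->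
  approx_within (\int[mu]_(u in `[a, b]) phi u)%E 0 (B * (b - a)).
Proof.
move=> ab mphi h.
rewrite (_ : 0 = (0 : {poly R}).[b] - (0 : {poly R}).[a]); last first.
  by rewrite !horner0 subr0.
by apply: approx_within_integral => // u /h; rewrite deriv0 horner0.
Qed.

(** Antiderivative, vanishing at 0, of the polynomial with coefficients c. *)
Definition prim_poly (c : seq R) : {poly R} :=
  Poly (0 :: [seq c`_i / i.+1%:R | i <- iota 0 (size c)]).

Lemma deriv_prim_poly c : deriv (prim_poly c) = Poly c.
Proof.
apply/polyP => i; rewrite coef_deriv !coef_Poly/=.
have [ic|ic] := ltnP i (size c).
  rewrite (nth_map 0%N) ?size_iota// nth_iota// add0n -[LHS]mulr_natr.
  by rewrite divfK// pnatr_eq0.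
by rewrite !nth_default ?mul0rn// size_map size_iota.
Qed.

End ereal_approximation.

(** * Expansions in the radius *)

Section integral_tools.
Local Open Scope ereal_scope.
Context (R : realType).
Local Notation mu := (@lebesgue_measure R).

(** Measurability of a partial integral, from Tonelli's theorem. *)
Lemma measurable_integral_param d (T : measurableType d)
    (F : T * R -> \bar R) (D : set R) :
  measurable_fun setT F -> (forall z, 0 <= F z) -> measurable D ->
  measurable_fun setT (fun u => \int[mu]_(v in D) F (u, v)).
Proof.
move=> mF F0 mD.
have mG : measurable_fun setT (fun z : T * R => F z * (\1_D z.2)%:E).
  apply: emeasurable_funM => //; apply/measurable_EFinP.
  by apply: (@measurableT_comp _ _ _ _ _ _ (\1_D : R -> R)).
have G0 z : 0 <= F z * (\1_D z.2)%:E by rewrite mule_ge0 ?lee_fin.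
have : measurable_fun setT (fubini_F mu (fun z : T * R => F z * (\1_D z.2)%:E)).
  exact: measurable_fun_fubini_tonelli_F.
apply: eq_measurable_fun => u _; rewrite /fubini_F [RHS]integral_mkcond.
apply: eq_integral => v _; rewrite patchE /= indicE.
by case: (v \in D); rewrite ?mule1 ?mule0.
Qed.

Lemma ge0_integral_split (f : R -> \bar R) (a b c : R) :
  (a <= b)%R -> (b <= c)%R ->
  measurable_fun `[a, c] f -> (forall x, 0 <= f x) ->
  \int[mu]_(x in `[a, c]) f x =
  \int[mu]_(x in `[a, b]) f x + \int[mu]_(x in `[b, c]) f x.
Proof.
move=> ab bc mf f0.
have mfS (D : set R) : D `<=` `[a, c] -> measurable_fun D f.
  by move=> DS; apply: measurable_funS mf.
have E : `[a, c]%classic = `[a, b[ `|` `[b, c] :> set R.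
  by rewrite -itv_bndbnd_setU ?bnd_simp.
rewrite {1}E ge0_integral_setU//=; last 2 first.
- by rewrite -E; exact: mfS.
- apply/disj_setPS => x /=; rewrite !in_itv/= => -[/andP[_ h] /andP[h' _]].
  by move: (lt_le_trans h h'); rewrite ltxx.
rewrite integral_itv_bndo_bndc//; apply: mfS => x /=; rewrite !in_itv/=.
by move=> /andP[-> h]; rewrite (le_trans (ltW h)).
Qed.

End integral_tools.

Section expansions.
Context (R : realType) (g : R -> R).
Hypothesis gper : periodic g 1.
Hypothesis g_ge0 : forall x, 0 <= g x.
Hypothesis gsm : bounded_fourth_derivative g.
Local Notation mu := (@lebesgue_measure R).

Lemma derivable_continuous (h : R -> R) :
  (forall x, derivable h x 1) -> continuous h.
Proof.
by move=> dh x; apply: differentiable_continuous; exact/derivable1_diffP.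
Qed.

Lemma continuous_derive1n k : (k < 4)%N -> continuous (derive1n k g).
Proof. by move=> k4; apply: derivable_continuous => x; exact: gsm.1. Qed.

Lemma measurable_derive1n k : (k < 4)%N -> measurable_fun setT (derive1n k g).
Proof. by move=> /continuous_derive1n; exact: continuous_measurable_fun. Qed.

Let mg : measurable_fun setT g.
Proof. exact: (@measurable_derive1n 0). Qed.

Lemma derive1n_bounded : exists2 B : R, 0 <= B &
  forall k x, (k < 4)%N -> 0 <= x <= 1 -> `|derive1n k g x| <= B.
Proof.
have h k : (k < 4)%N -> exists2 c : R, c \in `[0, 1]%R &
    forall x, x \in `[0, 1]%R -> `|derive1n k g x| <= `|derive1n k g c|.
  move=> k4; apply: (@EVT_max _ (fun x => `|derive1n k g x|)) => //.
  apply: continuous_subspaceT => x.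
  by apply: continuous_comp; [exact: continuous_derive1n|exact: norm_continuous].
have {}h n : (n <= 4)%N -> exists2 B : R, 0 <= B &
    forall k x, (k < n)%N -> 0 <= x <= 1 -> `|derive1n k g x| <= B.
  elim: n => [_|n IH n4]; first by exists 0.
  have [B B0 hB] := IH (ltnW n4); have [c _ hc] := h n n4.
  exists (B + `|derive1n n g c|); first by rewrite addr_ge0.
  move=> k x; rewrite ltnS leq_eqVlt => /predU1P[->|kn] x01.
    by rewrite (le_trans (hc _ _)) ?lerDr// in_itv.
  by rewrite (le_trans (hB _ _ kn x01))// lerDl.
exact: h.
Qed.

(** Coefficients of the cubic Taylor polynomial of g at x. *)
Definition taylor_coefs (x : R) : seq R :=
  [:: g x; derive1n 1 g x; derive1n 2 g x / 2; derive1n 3 g x / 6].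

Lemma taylor_poly_coefs x : taylor_poly 4 g x = Poly (taylor_coefs x).
Proof.
apply/polyP => i; rewrite coef_poly coef_Poly.
case: i => [|[|[|[|i]]]] //=; rewrite ?nth_nil// ?factE ?divr1//.
Qed.

(** Integral of g over [x + a, x + b]. *)
Definition window (x a b : R) : \bar R :=
  (\int[mu]_(v in `[a, b]) (g (x + v))%:E)%E.

Lemma measurable_shiftg (x : R) : measurable_fun setT (fun v : R => (g (x + v))%:E).
Proof.
apply/measurable_EFinP; apply: measurableT_comp => //.
exact: measurable_funD.
Qed.

Lemma window_ge0 x a b : (0 <= window x a b)%E.
Proof. by apply: integral_ge0 => v _; rewrite lee_fin. Qed.

Lemma window_shift x u a b : window (x + u) a b = window x (u + a) (u + b).
Proof.
rewrite /window [RHS](@ge0_integral_shift _ u)//=; first last.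
- by move=> v _; rewrite lee_fin.
- exact: measurable_funTS (measurable_shiftg x).
rewrite [X in _ = integral _ X _](_ : _ = `[a, b]%classic); last first.
  by apply/seteqP; split => v /=; rewrite !in_itv/= ![u + _]addrC !lerD2r.
by apply: eq_integral => v _; rewrite -addrA [u + v]addrC.
Qed.

Lemma measurable_window a b : measurable_fun setT (fun x : R => window x a b).
Proof.
apply: (@measurable_integral_param _ _ _ (fun z : R * R => (g (z.1 + z.2))%:E)).
- by apply/measurable_EFinP; apply: measurableT_comp => //; exact: measurable_funD.
- by move=> z; rewrite lee_fin.
- exact: measurable_itv.
Qed.

Lemma ler_norm_mul1 (a b c : R) : `|a| <= c -> `|b| <= 1 -> `|a * b| <= c.
Proof.
move=> ha hb; rewrite normrM -[c]mulr1; apply: ler_pM => //.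
Qed.

Lemma horner_poly4_bound (a0 a1 a2 a3 B w : R) :
  `|a0| <= B -> `|a1| <= B -> `|a2| <= B -> `|a3| <= B -> `|w| <= 1 ->
  `|(Poly [:: a0; a1; a2; a3]).[w]| <= 4 * B.
Proof.
move=> h0 h1 h2 h3 w1.
have Xw n : `|w ^+ n| <= 1 by rewrite normrX exprn_ile1.
have k1 := ler_norm_mul1 h1 (Xw 1%N); have k2 := ler_norm_mul1 h2 (Xw 2).
have k3 := ler_norm_mul1 h3 (Xw 3); rewrite horner_Poly/=.
rewrite (_ : _ + a0 = a0 + a1 * w ^+ 1 + a2 * w ^+ 2 + a3 * w ^+ 3); last by ring.
rewrite (_ : 4 * B = B + B + B + B); last by ring.
do 3 (apply: le_trans (ler_normD _ _) _; apply: lerD => //).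
Qed.

(** Coefficients of the product of a cubic and a quartic. *)
Definition mul_coefs (a0 a1 a2 a3 b0 b1 b2 b3 b4 : R) : seq R :=
  [:: a0 * b0; a0 * b1 + a1 * b0; a0 * b2 + a1 * b1 + a2 * b0;
      a0 * b3 + a1 * b2 + a2 * b1 + a3 * b0;
      a0 * b4 + a1 * b3 + a2 * b2 + a3 * b1;
      a1 * b4 + a2 * b3 + a3 * b2; a2 * b4 + a3 * b3; a3 * b4].

Lemma horner_mul_coefs (a0 a1 a2 a3 b0 b1 b2 b3 b4 u : R) :
  (Poly (mul_coefs a0 a1 a2 a3 b0 b1 b2 b3 b4)).[u] =
  (Poly [:: a0; a1; a2; a3]).[u] * (Poly [:: b0; b1; b2; b3; b4]).[u].
Proof. by rewrite !horner_Poly/=; ring. Qed.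

Lemma horner_prim4 (a0 a1 a2 a3 u : R) : (prim_poly [:: a0; a1; a2; a3]).[u] =
  a0 * u + a1 / 2 * u ^+ 2 + a2 / 3 * u ^+ 3 + a3 / 4 * u ^+ 4.
Proof. by rewrite horner_Poly/=; field. Qed.

Lemma horner_prim8 (c0 c1 c2 c3 c4 c5 c6 c7 u : R) :
  (prim_poly [:: c0; c1; c2; c3; c4; c5; c6; c7]).[u] =
  c0 * u + c1 / 2 * u ^+ 2 + c2 / 3 * u ^+ 3 + c3 / 4 * u ^+ 4 +
  c4 / 5 * u ^+ 5 + c5 / 6 * u ^+ 6 + c6 / 7 * u ^+ 7 + c7 / 8 * u ^+ 8.
Proof. by rewrite horner_Poly/=; field. Qed.

(** Coefficients in u of T(u) (Q(u + r) - Q(u - r)), where T has coefficients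
    a0, ..., a3 and Q is the antiderivative of T. *)
Definition sliding_coefs (a0 a1 a2 a3 r : R) : seq R :=
  mul_coefs a0 a1 a2 a3 (2 * r * a0 + 2 / 3 * r ^+ 3 * a2)
    (2 * r * a1 + 2 * r ^+ 3 * a3) (2 * r * a2) (2 * r * a3) 0.

Lemma horner_sliding_coefs (a0 a1 a2 a3 r u : R) :
  let Q := prim_poly [:: a0; a1; a2; a3] in
  (Poly (sliding_coefs a0 a1 a2 a3 r)).[u] =
  (Poly [:: a0; a1; a2; a3]).[u] * (Q.[u + r] - Q.[u - r]).
Proof.
move=> Q; rewrite horner_mul_coefs /Q !horner_prim4; congr (_ * _).
by rewrite horner_Poly/=; field.
Qed.

(** Coefficients in u of T(u) (Q(r) - Q(u - r)). *)
Definition right_coefs (a0 a1 a2 a3 r : R) : seq R :=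
  mul_coefs a0 a1 a2 a3 (2 * r * a0 + 2 / 3 * r ^+ 3 * a2)
    (- (a0 - a1 * r + a2 * r ^+ 2 - a3 * r ^+ 3))
    (- (a1 - 2 * a2 * r + 3 * a3 * r ^+ 2) / 2)
    (- (a2 - 3 * a3 * r) / 3) (- a3 / 4).

Lemma horner_right_coefs (a0 a1 a2 a3 r u : R) :
  let Q := prim_poly [:: a0; a1; a2; a3] in
  (Poly (right_coefs a0 a1 a2 a3 r)).[u] =
  (Poly [:: a0; a1; a2; a3]).[u] * (Q.[r] - Q.[u - r]).
Proof.
move=> Q; rewrite horner_mul_coefs /Q !horner_prim4; congr (_ * _).
by rewrite horner_Poly/=; field.
Qed.

(** Coefficients in u of T(u) (Q(u + r) - Q(- r)). *)
Definition left_coefs (a0 a1 a2 a3 r : R) : seq R :=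
  mul_coefs a0 a1 a2 a3 (2 * r * a0 + 2 / 3 * r ^+ 3 * a2)
    (a0 + a1 * r + a2 * r ^+ 2 + a3 * r ^+ 3)
    ((a1 + 2 * a2 * r + 3 * a3 * r ^+ 2) / 2)
    ((a2 + 3 * a3 * r) / 3) (a3 / 4).

Lemma horner_left_coefs (a0 a1 a2 a3 r u : R) :
  let Q := prim_poly [:: a0; a1; a2; a3] in
  (Poly (left_coefs a0 a1 a2 a3 r)).[u] =
  (Poly [:: a0; a1; a2; a3]).[u] * (Q.[u + r] - Q.[- r]).
Proof.
move=> Q; rewrite horner_mul_coefs /Q !horner_prim4; congr (_ * _).
by rewrite horner_Poly/=; field.
Qed.

Lemma ler_norm_mul2 (a b B : R) : `|a| <= B -> `|b| <= B -> `|a * b| <= B ^+ 2.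
Proof. by move=> ha hb; rewrite normrM expr2 ler_pM. Qed.

(** Bound for the terms of order 6 and more left by the two exact computations
    below. *)
Lemma remainder_bound (a1 a2 a3 r B k1 k2 k3 : R) :
  `|a1| <= B -> `|a2| <= B -> `|a3| <= B -> 0 < r -> r <= 2^-1 ->
  0 <= k1 <= 3 -> 0 <= k2 <= 3 -> 0 <= k3 <= 3 ->
  `|r ^+ 6 * (k1 * (a1 * a3) + k2 * (a2 * a2) + k3 * (a3 * a3 * r ^+ 2))| <=
  9 * B ^+ 2 * r ^+ 6.
Proof.
move=> h1 h2 h3 r0 r2 k1b k2b k3b; have r6 : 0 <= r ^+ 6 by rewrite exprn_ge0 ?ltW.
have K k (e : R) : 0 <= k <= 3 -> `|e| <= B ^+ 2 -> `|k * e| <= 3 * B ^+ 2.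
  by move=> /andP[k0 k3'] he; rewrite normrM ger0_norm// ler_pM.
rewrite normrM (ger0_norm r6) mulrC ler_wpM2r//.
rewrite (_ : 9 * B ^+ 2 = 3 * B ^+ 2 + 3 * B ^+ 2 + 3 * B ^+ 2); last by ring.
apply: le_trans (ler_normD _ _) _; apply: lerD.
  apply: le_trans (ler_normD _ _) _; apply: lerD.
    by apply: K => //; exact: ler_norm_mul2.
  by apply: K => //; exact: ler_norm_mul2.
apply: K => //; apply: ler_norm_mul1; first exact: ler_norm_mul2.
by rewrite normrX exprn_ile1// ger0_norm ?ltW//; lra.
Qed.

(** Integral over |u| <= r, |v| <= r of T(u) T(u + v), with the notation of
    [sliding_coefs]. *)
Lemma sliding_moments (a0 a1 a2 a3 r : R) :
  let P := prim_poly (sliding_coefs a0 a1 a2 a3 r) in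
  P.[r] - P.[- r] =
  4 * r ^+ 2 * a0 ^+ 2 + r ^+ 4 / 3 * (4 * a1 ^+ 2 + 6 * a0 * (2 * a2)) +
  r ^+ 6 * (44 / 15 * (a1 * a3) + 56 / 45 * (a2 * a2)
            + 48 / 35 * (a3 * a3 * r ^+ 2)).
Proof. by cbv zeta; rewrite !horner_prim8; field. Qed.

(** Integral of T(u) T(v) over the hexagon |u|, |v|, |u - v| <= r, cut along
    u = 0. *)
Lemma hexagon_moments (a0 a1 a2 a3 r : R) :
  let Pl := prim_poly (left_coefs a0 a1 a2 a3 r) in
  let Pr := prim_poly (right_coefs a0 a1 a2 a3 r) in
  Pl.[0] - Pl.[- r] + (Pr.[r] - Pr.[0]) =
  3 * r ^+ 2 * a0 ^+ 2 + 5 * r ^+ 4 / 12 * (a1 ^+ 2 + 2 * a0 * (2 * a2)) +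
  r ^+ 6 * (7 / 15 * (a1 * a3) + 7 / 30 * (a2 * a2)
            + 69 / 560 * (a3 * a3 * r ^+ 2)).
Proof. by cbv zeta; rewrite !horner_prim8; field. Qed.

Lemma measurable_sliding (x r : R) :
  measurable_fun setT (fun u : R => (g (x + u))%:E * window x (u - r) (u + r))%E.
Proof.
apply: emeasurable_funM; first exact: measurable_shiftg.
apply: (eq_measurable_fun (fun u => window (x + u) (- r) r)).
  by move=> u _; rewrite window_shift.
apply: (measurableT_comp (measurable_window (- r) r)).
exact: measurable_funD.
Qed.

(** Integral of g (x + v) over the v in [-r, r] within r of u on the circle: x and
    x + u being adjacent, the mass of their common neighbours. *)
Definition triangle_weight (r x u : R) : \bar R :=
  (\int[mu]_(v in `[(- r)%R, r]) ((g (x + v))%:E * (circ_ker r (u - v))%:E))%E.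

Lemma triangle_weight_ge0 r x u : (0 <= triangle_weight r x u)%E.
Proof.
by apply: integral_ge0 => v _; rewrite mule_ge0 ?lee_fin ?circ_ker_ge0.
Qed.

Lemma measurable_triangle_weight r x :
  measurable_fun setT (triangle_weight r x).
Proof.
apply: (@measurable_integral_param _ _ _
  (fun z : R * R => (g (x + z.2))%:E * (circ_ker r (z.1 - z.2))%:E)%E).
- apply: emeasurable_funM; apply/measurable_EFinP.
    apply: measurableT_comp => //; exact: measurable_funD.
  apply: (measurableT_comp (measurable_circ_ker r)); exact: measurable_funB.
- by move=> z; rewrite mule_ge0 ?lee_fin ?circ_ker_ge0.
- exact: measurable_itv.
Qed.

Lemma triangle_weight_le r x u : (triangle_weight r x u <= window x (- r) r)%E.
Proof.
apply: ge0_le_integral => //.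
- by move=> v _; rewrite mule_ge0 ?lee_fin ?circ_ker_ge0.
- apply: emeasurable_funM; apply: measurable_funTS.
    exact: measurable_shiftg.
  apply/measurable_EFinP; apply: (measurableT_comp (measurable_circ_ker r)).
  exact: measurable_funB.
- exact: measurable_funTS (measurable_shiftg x).
- by move=> v _; rewrite -EFinM lee_fin ler_piMr// circ_ker_le1.
Qed.

(** Below 1/3 two points of [x - r, x + r] are never within r of each other
    around the other side of the circle, so that the common neighbours of x and
    x + u form an interval. *)
Lemma triangle_weight_window r x u a b : 0 < r -> r < 3^-1 -> `|u| <= r ->
  (forall v, (- r <= v <= r) && (`|u - v| <= r) = (a <= v <= b)) ->
  triangle_weight r x u = window x a b.
Proof.
move=> r0 r3 ur h; rewrite /triangle_weight /window.
rewrite integral_mkcond [RHS]integral_mkcond; apply: eq_integral => v _.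
rewrite !patchE !mem_setE !in_itv/= -h.
case: ifPn => [vr|] /=; last by [].
move: ur vr; rewrite ler_norml => /andP[u1 u2] /andP[v1 v2].
rewrite circ_ker_near//; [|lra|]; last first.
  apply: (@le_lt_trans _ _ (2 * r)); last lra.
  by rewrite ler_norml; apply/andP; split; lra.
by case: ifP; rewrite ?mule1 ?mule0.
Qed.

Lemma triangle_weight_right r x u : 0 < r -> r < 3^-1 -> 0 <= u <= r ->
  triangle_weight r x u = window x (u - r) r.
Proof.
move=> r0 r3 /andP[u0 ur]; apply: triangle_weight_window => //.
  by rewrite ger0_norm.
move=> v; rewrite ler_norml; apply/idP/idP; first lra.
by move=> /andP[? ?]; apply/andP; split; apply/andP; split; lra.
Qed.

Lemma triangle_weight_left r x u : 0 < r -> r < 3^-1 -> - r <= u <= 0 ->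
  triangle_weight r x u = window x (- r) (u + r).
Proof.
move=> r0 r3 /andP[u0 ur]; apply: triangle_weight_window => //.
  by rewrite ler0_norm//; lra.
move=> v; rewrite ler_norml; apply/idP/idP; first lra.
by move=> /andP[? ?]; apply/andP; split; apply/andP; split; lra.
Qed.

Section at_point.
Variables (B M x : R).
Hypothesis B0 : 0 <= B.
Hypothesis M0 : 0 <= M.
Hypothesis hB : forall k, (k < 4)%N -> `|derive1n k g x| <= B.
Hypothesis hM : forall y, `|derive1n 4 g y| <= M.

Let T := Poly (taylor_coefs x).
Let Q := prim_poly (taylor_coefs x).

Let T_approx w : `|g (x + w) - T.[w]| <= M * `|w| ^+ 4.
Proof.
rewrite /T -taylor_poly_coefs; apply: taylor_bound => //.
by move=> k y; exact: gsm.1.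
Qed.

Let coef_bounds : [/\ `|g x| <= B, `|derive1n 1 g x| <= B,
  `|derive1n 2 g x / 2| <= B & `|derive1n 3 g x / 6| <= B].
Proof.
split; [exact: (hB (k := 0))|exact: (hB (k := 1))| |];
  apply: ler_norm_mul1; rewrite ?hB// normfV ger0_norm// invf_le1//; lra.
Qed.

Let T_bound w : `|w| <= 1 -> `|T.[w]| <= 4 * B.
Proof.
by move=> w1; have [h0 h1 h2 h3] := coef_bounds; exact: horner_poly4_bound.
Qed.

Let g_bound w : `|w| <= 1 -> `|g (x + w)| <= 4 * B + M.
Proof.
move=> w1; have h1 := T_bound w1; have h2 := T_approx w.
have h3 : M * `|w| ^+ 4 <= M by rewrite ler_piMr// exprn_ile1.
rewrite -[g _](subrK T.[w]) addrC; apply: le_trans (ler_normD _ _) _.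
by rewrite lerD// (le_trans h2).
Qed.

Let window_approx a b c : a <= b -> `|a| <= c -> `|b| <= c ->
  approx_within (window x a b) (Q.[b] - Q.[a]) (M * c ^+ 4 * (b - a)).
Proof.
move=> ab ac bc; apply: approx_within_integral => //.
  exact: measurable_funTS (measurable_shiftg x).
move=> u /andP[au ub]; rewrite deriv_prim_poly approx_withinE.
apply: le_trans (T_approx u) _; rewrite ler_wpM2l// lerXn2r ?nnegrE//.
  by rewrite (le_trans _ ac).
move: ac bc; rewrite !ler_norml => /andP[? ?] /andP[? ?].
by apply/andP; split; lra.
Qed.

Lemma window_bound a b : a <= b -> `|a| <= 1 -> `|b| <= 1 ->
  approx_within (window x a b) 0 ((4 * B + M) * (b - a)).
Proof.
move=> ab ac bc; apply: approx_within_integral_cst => //.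
  exact: measurable_funTS (measurable_shiftg x).
move=> u /andP[au ub]; rewrite approx_withinE subr0 g_bound//.
move: ac bc; rewrite !ler_norml => /andP[? ?] /andP[? ?].
by apply/andP; split; lra.
Qed.

Lemma window_mul_bound u a b : a <= b -> `|a| <= 1 -> `|b| <= 1 -> `|u| <= 1 ->
  approx_within ((g (x + u))%:E * window x a b) 0 ((4 * B + M) ^+ 2 * (b - a)).
Proof.
move=> ab ac bc uc.
have h1 : approx_within (g (x + u))%:E 0 (4 * B + M).
  by rewrite approx_withinE subr0 g_bound.
have h2 := window_bound ab ac bc.
have n0 : `|0 : R| <= 0 by rewrite normr0.
have := approx_withinM h1 h2 n0 h2; rewrite mulr0 => /approx_withinW; apply.
by rewrite subrr normr0 add0r mul0r addr0 mulrAC expr2.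
Qed.

(** In [window_mul_approx] both factors are replaced by polynomials: the first
    costs M r ^ 4 against a second factor at most 2 r (4 B + M), the second
    16 M r ^ 4 on an interval of length at most 2 r, against a first factor at
    most 4 B. *)
Definition error_cst := 2 * (4 * B + M) * M + 4 * B * (32 * M).

Let window_mul_approx r u a b : 0 < r -> r <= 2^-1 -> `|u| <= r ->
  a <= b -> `|a| <= 2 * r -> `|b| <= 2 * r -> b - a <= 2 * r ->
  approx_within ((g (x + u))%:E * window x a b) (T.[u] * (Q.[b] - Q.[a]))
    (error_cst * r ^+ 5).
Proof.
move=> r0 r2 ur ab ar br bar.
have r4 : 0 <= r ^+ 4 by rewrite exprn_ge0 ?ltW.
have h1 : approx_within (g (x + u))%:E T.[u] (M * r ^+ 4).
  rewrite approx_withinE; apply: le_trans (T_approx u) _.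
  by rewrite ler_wpM2l// lerXn2r ?nnegrE// ltW.
have h2 : approx_within (window x a b) (Q.[b] - Q.[a])
    (M * (2 * r) ^+ 4 * (2 * r)).
  apply: approx_withinW (window_approx ab ar br) _.
  by rewrite subrr normr0 add0r ler_wpM2l// mulr_ge0// exprn_ge0; lra.
have h3 : `|T.[u]| <= 4 * B by apply: T_bound; lra.
have h4 : approx_within (window x a b) 0 ((4 * B + M) * (2 * r)).
  apply: approx_withinW (window_bound ab _ _) _; try lra.
  by rewrite subrr normr0 add0r ler_wpM2l// addr_ge0// mulr_ge0.
apply: approx_withinW (approx_withinM h1 h2 h3 h4) _.
rewrite subrr normr0 add0r /error_cst [leRHS]mulrDl; apply: lerD.
  by rewrite le_eqVlt; apply/orP; left; apply/eqP; ring.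
by rewrite le_eqVlt; apply/orP; left; apply/eqP; ring.
Qed.

Let a2E : derive1n 2 g x = 2 * (derive1n 2 g x / 2).
Proof. by field. Qed.

(** The even terms of the Taylor polynomial integrate to the expansion; the odd
    ones cancel. *)
Lemma window_expansion r : 0 < r -> r <= 2^-1 ->
  approx_within (window x (- r) r)
    (2 * r * g x + derive1n 2 g x / 3 * r ^+ 3) (2 * M * r ^+ 5).
Proof.
move=> r0 r2; have rr : - r <= r by lra.
have nr : `|r| <= r by rewrite ger0_norm// ltW.
have nNr : `|- r| <= r by rewrite normrN.
apply: approx_withinW (window_approx rr nNr nr) _.
rewrite [X in `|X|](_ : _ = 0); last by rewrite !horner_prim4; field.
by rewrite normr0 add0r le_eqVlt; apply/orP; left; apply/eqP; ring.
Qed.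

Lemma sliding_expansion r : 0 < r -> r <= 2^-1 ->
  approx_within
    (\int[mu]_(u in `[(- r)%R, r]) ((g (x + u))%:E * window x (u - r)%R (u + r)%R))%E
    (4 * r ^+ 2 * g x ^+ 2 +
     r ^+ 4 / 3 * (4 * derive1n 1 g x ^+ 2 + 6 * g x * derive1n 2 g x))
    ((2 * error_cst + 9 * B ^+ 2) * r ^+ 6).
Proof.
move=> r0 r2; have rr : - r <= r by lra.
have [_ h1 h2 h3] := coef_bounds.
pose P := prim_poly (sliding_coefs (g x) (derive1n 1 g x) (derive1n 2 g x / 2)
                                   (derive1n 3 g x / 6) r).
have mphi : measurable_fun `[- r, r]
    (fun u => (g (x + u))%:E * window x (u - r) (u + r))%E.
  exact: measurable_funTS (measurable_sliding x r).
have approx u : - r <= u <= r -> approx_within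
    ((g (x + u))%:E * window x (u - r) (u + r)) (deriv P).[u]
    (error_cst * r ^+ 5).
  move=> /andP[u1 u2]; rewrite deriv_prim_poly horner_sliding_coefs.
  by apply: window_mul_approx => //; rewrite ?ler_norml; try lra;
    apply/andP; split; lra.
apply: approx_withinW (approx_within_integral rr mphi approx) _.
rewrite sliding_moments -a2E addrAC subrr add0r [leRHS]mulrDl addrC; apply: lerD.
  by rewrite le_eqVlt; apply/orP; left; apply/eqP; ring.
by apply: remainder_bound => //; lra.
Qed.

Let hexagon_measurable r (D : set R) : measurable_fun D
  (fun u => (g (x + u))%:E * triangle_weight r x u)%E.
Proof.
apply: measurable_funTS; apply: emeasurable_funM; first exact: measurable_shiftg.
exact: measurable_triangle_weight.
Qed.

Let hexagon_small r : 0 < r -> r < 3^-1 ->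
  approx_within
    (\int[mu]_(u in `[(- r)%R, r]) ((g (x + u))%:E * triangle_weight r x u))%E
    (3 * r ^+ 2 * g x ^+ 2 + 5 * r ^+ 4 / 12 *
       (derive1n 1 g x ^+ 2 + 2 * g x * derive1n 2 g x))
    ((2 * error_cst + 9 * B ^+ 2) * r ^+ 6).
Proof.
move=> r0 r3; have r2 : r <= 2^-1 by lra.
have [_ h1 h2 h3] := coef_bounds.
pose Pl := prim_poly (left_coefs (g x) (derive1n 1 g x) (derive1n 2 g x / 2)
                                 (derive1n 3 g x / 6) r).
pose Pr := prim_poly (right_coefs (g x) (derive1n 1 g x) (derive1n 2 g x / 2)
                                  (derive1n 3 g x / 6) r).
have rl : - r <= 0 by lra.
rewrite (ge0_integral_split rl (ltW r0))//; last first.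
  by move=> u; rewrite mule_ge0 ?lee_fin ?triangle_weight_ge0.
have al u : - r <= u <= 0 -> approx_within
    ((g (x + u))%:E * triangle_weight r x u) (deriv Pl).[u] (error_cst * r ^+ 5).
  move=> ur; rewrite triangle_weight_left// deriv_prim_poly horner_left_coefs.
  move/andP: ur => [u1 u2].
  by apply: window_mul_approx => //; rewrite ?ler_norml; try lra;
    apply/andP; split; lra.
have ar u : 0 <= u <= r -> approx_within
    ((g (x + u))%:E * triangle_weight r x u) (deriv Pr).[u] (error_cst * r ^+ 5).
  move=> ur; rewrite triangle_weight_right// deriv_prim_poly horner_right_coefs.
  move/andP: ur => [u1 u2].
  by apply: window_mul_approx => //; rewrite ?ler_norml; try lra;
    apply/andP; split; lra.
have := approx_withinD
  (approx_within_integral rl (hexagon_measurable r (D := _)) al)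
  (approx_within_integral (ltW r0) (hexagon_measurable r (D := _)) ar).
move=> /approx_withinW; apply.
rewrite hexagon_moments -a2E addrAC subrr add0r [leRHS]mulrDl addrC; apply: lerD.
  by rewrite le_eqVlt; apply/orP; left; apply/eqP; ring.
by apply: remainder_bound => //; lra.
Qed.

Let hexagon_bound r : 0 < r -> r <= 2^-1 ->
  approx_within
    (\int[mu]_(u in `[(- r)%R, r]) ((g (x + u))%:E * triangle_weight r x u))%E
    0 ((4 * B + M) ^+ 2 * (2 * r) * (2 * r)).
Proof.
move=> r0 r2; have rr : - r <= r by lra.
rewrite (_ : _ * (2 * r) * (2 * r) = (4 * B + M) ^+ 2 * (2 * r) * (r - - r));
  last by ring.
apply: approx_within_integral_cst => // u ur.
have := @window_mul_bound u (- r) r rr.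
rewrite !ler_norml => h.
have {h} : approx_within ((g (x + u))%:E * window x (- r) r) 0
    ((4 * B + M) ^+ 2 * (r - - r)).
  by move/andP: ur => [? ?]; apply: h; apply/andP; split; lra.
rewrite /approx_within !add0r => /andP[_ h]; apply/andP; split.
  rewrite (@le_trans _ _ 0%E) ?mule_ge0 ?lee_fin ?triangle_weight_ge0//.
  by rewrite oppr_le0; apply: mulr_ge0; [exact: sqr_ge0|lra].
rewrite (_ : 2 * r = r - - r); last by ring.
apply: le_trans h; rewrite lee_wpmul2l ?lee_fin//; exact: triangle_weight_le.
Qed.

(** The factor 729 = 3 ^ 6 serves radii at least 1/3. *)
Definition hexagon_cst := 2 * error_cst + 9 * B ^+ 2 +
  729 * ((4 * B + M) ^+ 2 + 3 * B ^+ 2 + 5 * B ^+ 2).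

Lemma hexagon_expansion r : 0 < r -> r <= 2^-1 ->
  approx_within
    (\int[mu]_(u in `[(- r)%R, r]) ((g (x + u))%:E * triangle_weight r x u))%E
    (3 * r ^+ 2 * g x ^+ 2 + 5 * r ^+ 4 / 12 *
       (derive1n 1 g x ^+ 2 + 2 * g x * derive1n 2 g x))
    (hexagon_cst * r ^+ 6).
Proof.
move=> r0 r2; have [r3|r3] := ltP r 3^-1.
  apply: approx_withinW (hexagon_small r0 r3) _.
  rewrite subrr normr0 add0r /hexagon_cst.
  apply: ler_wpM2r; [by rewrite exprn_ge0// ltW|rewrite lerDl].
  by have := sqr_ge0 (4 * B + M); have := sqr_ge0 B; lra.
(* Beyond 1/3 both sides are bounded and r ^+ 6 is at least 3 ^- 6. *)
apply: approx_withinW (hexagon_bound r0 r2) _.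
have [b0 b1 b2 _] := coef_bounds; rewrite a2E.
move: b0 b1 b2; move: (g x) (derive1n 1 g x) (derive1n 2 g x / 2) => a0 a1 a2.
move=> b0 b1 b2.
have r1 : `|r| <= 1 by rewrite ger0_norm ?ltW//; lra.
have rX n : `|r ^+ n| <= 1 by rewrite normrX exprn_ile1.
have k0 := ler_norm_mul1 (ler_norm_mul2 b0 b0) (rX 2%N).
have k1 := ler_norm_mul1 (ler_norm_mul2 b1 b1) (rX 4%N).
have k2 := ler_norm_mul1 (ler_norm_mul2 b0 b2) (rX 4%N).
have B2 : 0 <= B ^+ 2 by exact: sqr_ge0.
have BM2 : 0 <= (4 * B + M) ^+ 2 by exact: sqr_ge0.
have e0 : 0 <= error_cst.
  by rewrite /error_cst addr_ge0// !mulr_ge0// addr_ge0// mulr_ge0.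
have r6 : 1 <= 729 * r ^+ 6.
  rewrite (_ : 729 * r ^+ 6 = (3 * r) ^+ 6); last by ring.
  by apply: exprn_ege1; lra.
have r6p : 0 <= r ^+ 6 by rewrite exprn_ge0 ?ltW.
set X := (X in `|0 - X|).
have hX : `|X| <= 8 * B ^+ 2.
  rewrite /X [X in `|X|](_ : _ = 3 * (a0 * a0 * r ^+ 2) + 5 / 12 * (a1 * a1 * r ^+ 4)
    + 5 / 3 * (a0 * a2 * r ^+ 4)); last by field.
  move: k0 k1 k2 B2; rewrite !ler_norml.
  move: (_ * _ * _ ^+ _) (_ * _ * _ ^+ _) (_ * _ * _ ^+ _) (B ^+ 2) => x0 x1 x2 b.
  by move=> /andP[? ?] /andP[? ?] /andP[? ?] ?; apply/andP; split; lra.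
have hr : (4 * B + M) ^+ 2 * (2 * r) * (2 * r) <= (4 * B + M) ^+ 2.
  by rewrite -mulrA ler_piMr// -expr2 exprn_ile1//; lra.
rewrite sub0r normrN; apply: le_trans (lerD hX hr) _.
rewrite /hexagon_cst [leRHS]mulrDl; set S := (_ + _ + 5 * _).
rewrite (_ : 8 * B ^+ 2 + (4 * B + M) ^+ 2 = S); last by rewrite /S; ring.
have S0 : 0 <= S by rewrite /S !addr_ge0// mulr_ge0.
have : S <= 729 * S * r ^+ 6 by rewrite mulrAC ler_peMl.
have : 0 <= (2 * error_cst + 9 * B ^+ 2) * r ^+ 6.
  by rewrite mulr_ge0// addr_ge0// mulr_ge0.
lra.
Qed.

End at_point.

End expansions.

(** * Unfolding integrals over the circle *)

(** Indicator of adjacency of the points x and y, as a real number. *)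
Definition adj (R : realType) (r x y : R) : R := (circle_dist x y <= r)%R%:R.

Section unfolding.
Context (R : realType) (g : R -> R).
Hypothesis gper : periodic g 1.
Hypothesis g_ge0 : forall x, 0 <= g x.
Hypothesis gsm : bounded_fourth_derivative g.
Local Notation mu := (@lebesgue_measure R).

Lemma adj_ge0 (r x y : R) : 0 <= adj r x y.
Proof. exact: ler0n. Qed.

Lemma adj_le1 (r x y : R) : adj r x y <= 1.
Proof. by rewrite /adj lern1 leq_b1. Qed.

Lemma measurable_adj (r : R) :
  measurable_fun setT (fun z : R * R => adj r z.1 z.2).
Proof.
have mn : measurable_fun setT (fun z : R * R => `|z.1 - z.2|).
  by apply: measurableT_comp => //; exact: measurable_funB.
have md : measurable_fun setT (fun z : R * R => circle_dist z.1 z.2).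
  by apply: measurable_minr => //; exact: measurable_funB.
have mA : measurable [set z : R * R | circle_dist z.1 z.2 <= r].
  rewrite [X in measurable X](_ : _ =
    (fun z : R * R => circle_dist z.1 z.2) @^-1` `]-oo, r]%classic).
    by rewrite -[X in measurable X]setTI; apply: md => //; exact: measurable_itv.
  by apply/seteqP; split => z /=; rewrite in_itv.
rewrite (_ : (fun _ => _) = \1_[set z : R * R | circle_dist z.1 z.2 <= r]).
  exact: measurable_indic.
apply/funext => z; rewrite indicE /adj; congr (nat_of_bool _)%:R.
by apply/idP/idP; rewrite inE.
Qed.

Let g_ge0E y : (0 <= (g y)%:E)%E. Proof. by rewrite lee_fin. Qed.

Let mgE : measurable_fun setT (fun y => (g y)%:E).
Proof. by apply/measurable_EFinP; exact: (measurable_derive1n gsm (k := 0)). Qed.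

Lemma edge_integral (r x : R) : 0 < r -> r <= 2^-1 -> 0 <= x <= 1 ->
  (\int[mu]_(y in `[0%R, 1%R]) ((g y)%:E * (adj r x y)%:E) =
   window g x (- r) r)%E.
Proof.
move=> r0 r2 x01.
rewrite /window -(@integral_circ_ker _ (fun y => (g y)%:E))//; last first.
  by move=> y; rewrite gper.
by apply: eq_integral => y; rewrite inE/= in_itv/= => y01;
  rewrite /adj circle_dist_ker.
Qed.

Lemma sliding_integral (r x : R) : 0 < r -> r <= 2^-1 -> 0 <= x <= 1 ->
  (\int[mu]_(y in `[0%R, 1%R]) ((g y)%:E *
     ((adj r x y)%:E *
       \int[mu]_(z in `[0%R, 1%R]) ((g z)%:E * (adj r y z)%:E))) =
   \int[mu]_(u in `[(- r)%R, r])
     ((g (x + u)%R)%:E * window g x (u - r)%R (u + r)%R))%E.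
Proof.
move=> r0 r2 x01.
transitivity (\int[mu]_(u in `[(- r)%R, r])
     ((g (x + u)%R)%:E * window g (x + u) (- r) r))%E; last first.
  by apply: eq_integral => u _; rewrite window_shift.
rewrite -(@integral_circ_ker _ (fun y => (g y)%:E * window g y (- r) r)%E)//.
- apply: eq_integral => y; rewrite inE/= in_itv/= => y01.
  by rewrite edge_integral// /adj circle_dist_ker//
    [(_ * window _ _ _ _)%E in LHS]muleC muleA.
- by apply: emeasurable_funM => //; exact: measurable_window.
- by move=> y; rewrite mule_ge0 ?window_ge0.
- move=> y; rewrite gper; congr (_ * _)%E.
  by apply: eq_integral => v _; rewrite addrAC gper.
Qed.

Lemma triangle_integral (r x : R) : 0 < r -> r <= 2^-1 -> 0 <= x <= 1 ->
  (\int[mu]_(y in `[0%R, 1%R]) ((g y)%:E *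
     ((adj r x y)%:E *
       \int[mu]_(z in `[0%R, 1%R]) ((g z)%:E * ((adj r x z)%:E * (adj r y z)%:E)))) =
   \int[mu]_(u in `[(- r)%R, r])
     ((g (x + u)%R)%:E * triangle_weight g r x u))%E.
Proof.
move=> r0 r2 x01.
transitivity (\int[mu]_(u in `[(- r)%R, r])
     ((g (x + u)%R)%:E * triangle_weight g r x (x + u - x)))%E; last first.
  by apply: eq_integral => u _; rewrite addrAC subrr add0r.
have inner y : 0 <= y <= 1 ->
    (\int[mu]_(z in `[0%R, 1%R]) ((g z)%:E * ((adj r x z)%:E * (adj r y z)%:E))
     = triangle_weight g r x (y - x))%E.
  move=> y01; rewrite /triangle_weight.
  transitivity (\int[mu]_(v in `[(- r)%R, r])
      ((g (x + v)%R)%:E * (circ_ker r (y - (x + v))%R)%:E))%E; last first.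
    by apply: eq_integral => v _; rewrite opprD addrA.
  rewrite -(@integral_circ_ker _ (fun z => (g z)%:E * (circ_ker r (y - z))%:E)%E)//.
  - apply: eq_integral => z; rewrite inE/= in_itv/= => z01.
    by rewrite /adj !circle_dist_ker// -muleA [X in (_ * X)%E]muleC.
  - apply: emeasurable_funM => //; apply/measurable_EFinP.
    apply: (measurableT_comp (measurable_circ_ker r)); exact: measurable_funB.
  - by move=> z; rewrite mule_ge0 ?lee_fin ?circ_ker_ge0.
  - move=> z; rewrite gper (_ : y - z = y - (z + 1) + 1) ?circ_kerD1//.
    by ring.
rewrite -(@integral_circ_ker _ (fun y => (g y)%:E * triangle_weight g r x (y - x))%E)//.
- apply: eq_integral => y; rewrite inE/= in_itv/= => y01.
  by rewrite inner// /adj circle_dist_ker// muleA [RHS]muleAC.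
- apply: emeasurable_funM => //.
  apply: (@measurableT_comp _ _ _ _ _ _ (triangle_weight g r x) _
    (fun y : R => y - x)); first exact: measurable_triangle_weight.
  exact: measurable_funB.
- by move=> y; rewrite mule_ge0 ?triangle_weight_ge0.
- move=> y; rewrite gper; congr (_ * _)%E.
  apply: eq_integral => v _; rewrite -[in RHS]circ_kerD1.
  by congr (_ * (circ_ker r _)%:E)%E; ring.
Qed.

(** The conditional means of A12, A12 A23 and A12 A13 A23 given X1 = x, as
    integrals against the density. *)
Definition edge2 (r x : R) : \bar R :=
  (\int[mu]_(y in `[0%R, 1%R]) ((g y)%:E * (adj r x y)%:E))%E.
Definition path2 (r x : R) : \bar R :=
  (\int[mu]_(y in `[0%R, 1%R]) ((g y)%:E * ((adj r x y)%:E *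
       \int[mu]_(z in `[0%R, 1%R]) ((g z)%:E * (adj r y z)%:E))))%E.
Definition triangle (r x : R) : \bar R :=
  (\int[mu]_(y in `[0%R, 1%R]) ((g y)%:E * ((adj r x y)%:E *
       \int[mu]_(z in `[0%R, 1%R])
         ((g z)%:E * ((adj r x z)%:E * (adj r y z)%:E)))))%E.

(** The conditional mean of A12 A13 is the square of that of A12, by conditional
    independence; hence the second clause. *)
Lemma conditional_expansions : exists2 C : R, 0 <= C &
  forall r x, 0 < r -> r <= 2^-1 -> 0 <= x <= 1 ->
  [/\ approx_within (edge2 r x)
        (2 * r * g x + derive1n 2 g x / 3 * r ^+ 3) (C * r ^+ 5),
      approx_within (edge2 r x * edge2 r x)
        (4 * r ^+ 2 * g x ^+ 2 + 4 * r ^+ 4 / 3 * g x * derive1n 2 g x)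
        (C * r ^+ 6),
      approx_within (path2 r x)
        (4 * r ^+ 2 * g x ^+ 2 + r ^+ 4 / 3 *
           (4 * derive1n 1 g x ^+ 2 + 6 * g x * derive1n 2 g x))
        (C * r ^+ 6) &
      approx_within (triangle r x)
        (3 * r ^+ 2 * g x ^+ 2 + 5 * r ^+ 4 / 12 *
          (derive1n 1 g x ^+ 2 + 2 * g x * derive1n 2 g x))
        (C * r ^+ 6)].
Proof.
have [B B0 hB] := derive1n_bounded gsm.
have [M' hM'] := gsm.2; pose M := `|M'|.
have M0 : 0 <= M by exact: normr_ge0.
have hM y : `|derive1n 4 g y| <= M.
  by apply: le_trans (hM' y) _; exact: ler_norm.
pose C2 := (4 * B + M) * 2 * (2 * M) + (2 * M + (4 * B + M) * 2) * (2 * M) + B ^+ 2.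
pose C3 := 2 * error_cst B M + 9 * B ^+ 2.
have B2 : 0 <= B ^+ 2 by exact: sqr_ge0.
have BM : 0 <= 4 * B + M by rewrite addr_ge0// mulr_ge0.
have e0 : 0 <= error_cst B M.
  by rewrite /error_cst addr_ge0// !mulr_ge0.
have C20 : 0 <= C2 by rewrite /C2 !addr_ge0// !mulr_ge0// addr_ge0// mulr_ge0.
have C30 : 0 <= C3 by rewrite /C3 addr_ge0// mulr_ge0.
have H0 : 0 <= hexagon_cst B M.
  by have := sqr_ge0 (4 * B + M); rewrite /hexagon_cst; lra.
exists (2 * M + C2 + C3 + hexagon_cst B M); first lra.
move=> r x r0 r2 x01; set C := _ + _ + _ + _.
have hBx k : (k < 4)%N -> `|derive1n k g x| <= B by move=> k4; exact: hB.
have r5 : 0 <= r ^+ 5 by rewrite exprn_ge0 ?ltW.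
have r6 : 0 <= r ^+ 6 by rewrite exprn_ge0 ?ltW.
have weaken e q (K K' s : R) : K <= K' -> 0 <= s -> approx_within e q (K * s) ->
    approx_within e q (K' * s).
  move=> KK s0 /approx_withinW; apply.
  by rewrite subrr normr0 add0r ler_wpM2r.
have h1 := window_expansion gsm x M0 hM r0 r2.
rewrite /edge2 /path2 /triangle edge_integral// sliding_integral//.
rewrite triangle_integral//; split.
- by apply: weaken h1 => //; rewrite /C; lra.
- apply: (@weaken _ _ C2) => //; first by rewrite /C; lra.
  have h2 : approx_within (window g x (- r) r) 0 ((4 * B + M) * (2 * r)).
    rewrite (_ : 2 * r = r - - r); last by ring.
    by apply: (window_bound gsm M0 hBx hM); rewrite ?normrN ?ger0_norm; lra.
  have rle : r ^+ 5 <= r.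
    by rewrite exprS; apply: ler_piMr; [exact: ltW|rewrite exprn_ile1//; lra].
  have hq : `|2 * r * g x + derive1n 2 g x / 3 * r ^+ 3| <=
      (2 * M + (4 * B + M) * 2) * r.
    have [s sE hs] := approx_withinP h1.
    move: h2; rewrite sE approx_withinE subr0 => h2.
    rewrite -[X in `|X|](subrK s); apply: le_trans (ler_normD _ _) _.
    rewrite distrC [leRHS]mulrDl; apply: lerD; last by rewrite -mulrA.
    by apply: le_trans hs _; apply: ler_wpM2l => //; rewrite mulr_ge0.
  have := approx_withinM h1 h1 hq h2.
  move=> /approx_withinW; apply.
  rewrite (_ : _ - _ = r ^+ 6 * (derive1n 2 g x / 3) ^+ 2); last by field.
  rewrite normrM ger0_norm// normrX (_ : C2 * r ^+ 6 = r ^+ 6 * B ^+ 2 +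
    ((4 * B + M) * (2 * r) * (2 * M * r ^+ 5) +
     (2 * M + (4 * B + M) * 2) * r * (2 * M * r ^+ 5))); last first.
    by rewrite /C2; ring.
  rewrite lerD2r ler_wpM2l// lerXn2r ?nnegrE//.
  apply: ler_norm_mul1; first exact: hBx.
  by rewrite normfV ger0_norm// invf_le1//; lra.
- apply: (@weaken _ _ C3) => //; first by rewrite /C; lra.
  exact: (sliding_expansion g_ge0 gsm B0 M0 hBx hM r0 r2).
- apply: (@weaken _ _ (hexagon_cst B M)) => //; first by rewrite /C; lra.
  exact: (hexagon_expansion g_ge0 gsm B0 M0 hBx hM r0 r2).
Qed.

End unfolding.

(** * Joint law of three independent variables *)

Section joint_law.
Local Open Scope ereal_scope.
Context d (T : measurableType d) (R : realType) (P : probability T R).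
Variables (X1 X2 X3 : {RV P >-> R}).
Hypothesis indep : forall A B C : set R, measurable A -> measurable B ->
  measurable C ->
  P ((X1 @^-1` A) `&` (X2 @^-1` B) `&` (X3 @^-1` C)) =
  P (X1 @^-1` A) * P (X2 @^-1` B) * P (X3 @^-1` C).

Let mu1 : probability _ R := distribution P X1.
Let mu2 : probability _ R := distribution P X2.
Let mu3 : probability _ R := distribution P X3.

Let mu23 : probability (R * R)%type R := mu2 \x mu3.

Let Y (w : T) := (X2 w, X3 w).

Let mY : measurable_fun setT Y.
Proof. exact/measurable_fun_pairP. Qed.

Let XY (w : T) := (X1 w, Y w).

Let mXY : measurable_fun setT XY.
Proof. exact/measurable_fun_pairP. Qed.

(** For fixed A, both sides are measures of D that agree on rectangles. *)
Let law_XY (A : set R) (D : set (R * R)) : measurable A -> measurable D ->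
  pushforward P XY (A `*` D) = mu1 A * (mu2 \x mu3) D.
Proof.
move=> mA mD.
have mX1A : measurable (X1 @^-1` A).
  by rewrite -[_ @^-1` _]setTI; exact: measurable_funPT.
have p0 : (0 <= fine (mu1 A))%R by rewrite fine_ge0.
pose s := NngNum p0.
have sE : s%:num%:E = mu1 A by rewrite /= fineK// fin_num_measure.
have mpre (B : set (R * R)) : measurable B -> measurable (Y @^-1` B).
  by move=> mB; rewrite -[_ @^-1` _]setTI; exact: mY.
have mpreX (X : {RV P >-> R}) (B : set R) : measurable B -> measurable (X @^-1` B).
  by move=> mB; rewrite -[_ @^-1` _]setTI; exact: measurable_funPT.
transitivity ((mscale s mu2 \x mu3) D).
  have := @product_measure_unique _ _ _ _ R (mscale s mu2) mu3
    (@pushforward _ _ _ _ R (mrestr P mX1A) Y).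
  move=> -> //.
    rewrite [RHS](_ : _ = P (Y @^-1` D `&` X1 @^-1` A))//.
    by rewrite /pushforward setIC.
  move=> B C mB mC.
  transitivity (P (X1 @^-1` A `&` X2 @^-1` B `&` X3 @^-1` C)).
    rewrite [LHS](_ : _ = P (Y @^-1` (B `*` C) `&` X1 @^-1` A))//; congr (P _).
    by apply/seteqP; split => w /=; rewrite /Y /=; tauto.
  rewrite indep//; congr (_ * _).
  by rewrite [RHS](_ : _ = s%:num%:E * mu2 B)// sE.
rewrite -sE (_ : s%:num%:E * _ = mscale s (mu2 \x mu3) D)//.
apply: product_measure_unique => // B C mB mC.
rewrite [LHS](_ : _ = s%:num%:E * (mu2 \x mu3) (B `*` C))//.
by rewrite product_measure1E// muleA.
Qed.

(** Mean of phi (x, (X2, X3)). *)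
Definition cond_mean (phi : R * (R * R) -> \bar R) (x : R) : \bar R :=
  \int[mu2]_y \int[mu3]_z phi (x, (y, z)).

Let cond_meanE (phi : R * (R * R) -> \bar R) :
  measurable_fun setT phi -> (forall z, 0 <= phi z) ->
  cond_mean phi = fubini_F mu23 phi.
Proof.
move=> mphi phi0; apply/funext => x; rewrite /fubini_F /mu23 fubini_tonelli1//.
by apply: measurableT_comp => //; exact: measurable_pair1.
Qed.

Lemma measurable_cond_mean (phi : R * (R * R) -> \bar R) :
  measurable_fun setT phi -> (forall z, 0 <= phi z) ->
  measurable_fun setT (cond_mean phi).
Proof.
move=> mphi phi0; rewrite cond_meanE//.
exact: (@measurable_fun_fubini_tonelli_F _ _ _ _ R mu23 phi).
Qed.

Lemma cond_mean_ge0 (phi : R * (R * R) -> \bar R) x :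
  (forall z, 0 <= phi z) -> 0 <= cond_mean phi x.
Proof. by move=> phi0; apply: integral_ge0 => y _; exact: integral_ge0. Qed.

Lemma cond_mean_le1 (phi : R * (R * R) -> \bar R) x :
  measurable_fun setT phi -> (forall z, 0 <= phi z <= 1) -> cond_mean phi x <= 1.
Proof.
move=> mphi phi01; rewrite cond_meanE//; last by move=> z; case/andP: (phi01 z).
have one : \int[mu23]_z cst 1 z = 1.
  by rewrite integral_cst// mul1e; exact: probability_setT.
rewrite /fubini_F -[leRHS]one; apply: ge0_le_integral => //.
- by move=> z _; case/andP: (phi01 (x, z)).
- by apply: measurableT_comp => //; exact: measurable_pair1.
- by move=> z _; case/andP: (phi01 (x, z)).
Qed.

Lemma integral_cond_mean (phi : R * (R * R) -> \bar R) :
  measurable_fun setT phi -> (forall z, 0 <= phi z) ->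
  \int[P]_w phi (XY w) = \int[P]_w cond_mean phi (X1 w).
Proof.
move=> mphi phi0.
transitivity (\int[mu1 \x mu23]_z phi z).
  rewrite [LHS](_ : _ = \int[pushforward P XY]_z phi z); last first.
    by rewrite ge0_integral_pushforward.
  apply: eq_measure_integral => /= A mA _; apply/esym.
  apply: (@product_measure_unique _ _ _ _ R mu1 mu23
    (@pushforward _ _ _ _ R P XY)) => //.
rewrite (@fubini_tonelli1 _ _ _ _ R mu1 mu23 phi)// -cond_meanE//.
rewrite ge0_integral_distribution//; first exact: measurable_cond_mean.
by move=> x; exact: cond_mean_ge0.
Qed.

Lemma integral_cond_mean_preimage (phi : R * (R * R) -> \bar R) (B : set R) :
  measurable_fun setT phi -> (forall z, 0 <= phi z) -> measurable B ->
  \int[P]_(w in X1 @^-1` B) phi (XY w) =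
  \int[P]_(w in X1 @^-1` B) cond_mean phi (X1 w).
Proof.
move=> mphi phi0 mB.
pose psi z := (\1_B z.1)%:E * phi z.
have mpsi : measurable_fun setT psi.
  apply: emeasurable_funM => //; apply/measurable_EFinP.
  by apply: (@measurableT_comp _ _ _ _ _ _ (\1_B : R -> R)).
have psi0 z : 0 <= psi z by rewrite mule_ge0 ?lee_fin.
rewrite integral_mkcond [RHS]integral_mkcond.
transitivity (\int[P]_w psi (XY w)).
  apply: eq_integral => w _; rewrite patchE /psi /= indicE.
  rewrite [X in if X then _ else _](_ : _ = (X1 w \in B)); last first.
    by apply/idP/idP; rewrite !inE.
  by case: (X1 w \in B); rewrite ?mul1e ?mul0e.
rewrite integral_cond_mean//; apply: eq_integral => w _; rewrite patchE.
rewrite [X in if X then _ else _](_ : _ = (X1 w \in B)); last first.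
  by apply/idP/idP; rewrite !inE.
rewrite /cond_mean /psi /= indicE; case: (X1 w \in B).
  by apply: eq_integral => y _; apply: eq_integral => z _; rewrite mul1e.
by rewrite integral0_eq// => y _; rewrite integral0_eq// => z _; rewrite mul0e.
Qed.

End joint_law.

(** * Conditional expectations and means *)

Section cond_exp_unique.
Local Open Scope ereal_scope.
Context d (T : measurableType d) (R : realType) (P : probability T R).

Lemma ae_not_lt (U V : T -> R) :
  P.-integrable setT (EFin \o U) -> P.-integrable setT (EFin \o V) ->
  \int[P]_(w in [set w | (U w < V w)%R]) (U w)%:E =
  \int[P]_(w in [set w | (U w < V w)%R]) (V w)%:E ->
  {ae P, forall w, ~ (U w < V w)%R}.
Proof.
move=> iU iV; set D := [set w | _] => UV.
have mU : measurable_fun setT U.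
  by apply/measurable_EFinP; exact: measurable_int iU.
have mV : measurable_fun setT V.
  by apply/measurable_EFinP; exact: measurable_int iV.
have mD : measurable D.
  rewrite -[D]setTI (_ : D = [set w | (U w)%:E < (V w)%:E]).
    by apply: measurable_lte => //; exact/measurable_EFinP.
  by apply/seteqP; split => w /=; rewrite lte_fin.
have iUD : P.-integrable D (EFin \o U) by apply: integrableS iU.
have iVD : P.-integrable D (EFin \o V) by apply: integrableS iV.
have mVU : measurable_fun D (fun w => (V w)%:E - (U w)%:E).
  by apply: emeasurable_funB; [exact: measurable_int iVD|exact: measurable_int iUD].
have : \int[P]_(w in D) `|(V w)%:E - (U w)%:E| = 0.
  under eq_integral => w.
    rewrite inE => UVw; rewrite gee0_abs; last first.
      by rewrite -EFinB lee_fin subr_ge0 ltW.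
    over.
  rewrite integralB_EFin// -UV subee//.
  exact: (integrable_fin_num mD iUD).
move=> /(ae_eq_integral_abs P mD mVU); apply: filterS => w h UVw.
have /eqP := h UVw; rewrite -EFinB eqe subr_eq0 => /eqP VU.
by move: UVw; rewrite VU ltxx.
Qed.

(** U is measurable for the sigma-algebra generated by X. *)
Definition factors_through (X : T -> R) (U : T -> R) :=
  forall B : set R, measurable B ->
    exists2 C : set R, measurable C & X @^-1` C = U @^-1` B.

(** The event U < V is the union over the rationals q of U < q < V. *)
Lemma factors_through_lt (X U V : T -> R) :
  factors_through X U -> factors_through X V ->
  exists2 C : set R, measurable C & X @^-1` C = [set w | (U w < V w)%R].
Proof.
move=> fU fV.
have [CU hCU] := choice (fun q : rat =>
  let: ex_intro2 C mC e := fU `]-oo, ratr q[%classic (measurable_itv _) in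
  ex_intro (fun C => measurable C /\ X @^-1` C = U @^-1` `]-oo, ratr q[) C (conj mC e)).
have [CV hCV] := choice (fun q : rat =>
  let: ex_intro2 C mC e := fV `]ratr q, +oo[%classic (measurable_itv _) in
  ex_intro (fun C => measurable C /\ X @^-1` C = V @^-1` `]ratr q, +oo[) C (conj mC e)).
exists (\bigcup_(q : rat) (CU q `&` CV q)).
  apply: bigcupT_measurable_rat => q.
  by apply: measurableI; [exact: (hCU q).1|exact: (hCV q).1].
apply/seteqP; split => [w [q _ [h1 h2]]|w /= UV].
  have {}h1 : (X @^-1` CU q) w by [].
  have {}h2 : (X @^-1` CV q) w by [].
  move: h1 h2; rewrite (hCU q).2 (hCV q).2 /= !in_itv/= andbT => h1 h2.
  exact: lt_trans h1 h2.
have [q] := rat_in_itvoo UV; rewrite in_itv/= => /andP[Uq qV].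
exists q => //; split.
  suff : (X @^-1` CU q) w by [].
  by rewrite (hCU q).2 /= in_itv.
suff : (X @^-1` CV q) w by [].
by rewrite (hCV q).2 /= in_itv/= andbT.
Qed.

(** Both events Z < h (X) and h (X) < Z belong to the sigma-algebra of X, so that
    they are negligible by [ae_not_lt]. *)
Lemma cond_exp_ae_unique (X : {RV P >-> R}) (Y Z h : _ -> R) :
  is_cond_exp X Y Z -> measurable_fun setT h ->
  P.-integrable setT (EFin \o (h \o X)) ->
  (forall B : set R, measurable B ->
    \int[P]_(w in X @^-1` B) (Y w)%:E = \int[P]_(w in X @^-1` B) (h (X w))%:E) ->
  {ae P, forall w, Z w = h (X w)}.
Proof.
move=> [mZ iZ ZY] mh ih Yh.
have fZ : factors_through X Z.
  move=> B mB; have [C mC e] := mZ B mB.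
  by exists C => //; rewrite -e setTI.
have fh : factors_through X (h \o X).
  move=> B mB; exists (h @^-1` B) => //.
  by rewrite -[_ @^-1` _]setTI; exact: mh.
have Zh (C : set R) : measurable C -> \int[P]_(w in X @^-1` C) (Z w)%:E =
    \int[P]_(w in X @^-1` C) (h (X w))%:E.
  move=> mC; rewrite -Yh// ZY//; exists C => //; by rewrite setTI.
have lt1 : {ae P, forall w, ~ (Z w < (h \o X) w)%R}.
  apply: ae_not_lt => //; have [C mC <-] := factors_through_lt fZ fh.
  exact: Zh.
have lt2 : {ae P, forall w, ~ ((h \o X) w < Z w)%R}.
  apply: ae_not_lt => //; have [C mC <-] := factors_through_lt fh fZ.
  by rewrite Zh.
apply: filterS2 lt1 lt2 => w /negP; rewrite -leNgt => h1 /negP.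
by rewrite -leNgt => h2; apply/eqP; rewrite eq_le h2.
Qed.

End cond_exp_unique.

Section means.
Context d (T : measurableType d) (R : realType) (P : probability T R).
Variables (X : {RV P >-> R}) (g : R -> R).
Hypothesis Xg : has_density X (on_unit_interval g).
Implicit Types u v : R -> R.

Lemma ae_unit_interval : {ae P, forall w, 0 <= X w <= 1}.
Proof.
have mU : measurable (~` `[0, 1]%classic : set R) by apply: measurableC.
exists (X @^-1` (~` `[0, 1]%classic)); split.
- by rewrite -[_ @^-1` _]setTI; exact: measurable_funPT.
- rewrite (_ : P _ = distribution P X (~` `[0, 1]%classic))// Xg//.
  apply: integral0_eq => x xU.
  by rewrite /on_unit_interval indicE memNset// mulr0.
- by move=> w /= h; rewrite in_itv/=.
Qed.

Let mX u : measurable_fun setT u -> measurable_fun setT (u \o X).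
Proof. by move=> mu; apply: measurableT_comp. Qed.

Lemma measurable_on_unit_interval u :
  measurable_fun setT u -> measurable_fun setT (on_unit_interval u).
Proof.
by move=> mu; apply: measurable_funM => //; exact: measurable_indic.
Qed.

Lemma on_unit_intervalE u x : 0 <= x <= 1 -> on_unit_interval u x = u x.
Proof.
by move=> x01; rewrite /on_unit_interval indicE mem_set ?mulr1//= in_itv.
Qed.

Lemma on_unit_interval_out u x : ~~ (0 <= x <= 1) -> on_unit_interval u x = 0.
Proof.
move=> x01; rewrite /on_unit_interval indicE memNset ?mulr0//=.
by rewrite in_itv/=; exact/negP.
Qed.

(** Boundedness on [0, 1], which carries the law of X. *)
Definition bounded01 u := exists B, forall x, 0 <= x <= 1 -> `|u x| <= B.

Let ae_on u : ae_eq P setT (EFin \o (u \o X)) (EFin \o (on_unit_interval u \o X)).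
Proof.
by apply: filterS ae_unit_interval => w h _ /=; rewrite on_unit_intervalE.
Qed.

Lemma integrable_bounded01 u : measurable_fun setT u -> bounded01 u ->
  P.-integrable setT (EFin \o (u \o X)).
Proof.
move=> mu [B hB].
have i1 : P.-integrable setT (EFin \o (on_unit_interval u \o X)).
  apply: measurable_bounded_integrable => //.
  - by rewrite (le_lt_trans (probability_le1 _ _))// ltry.
  - by apply: mX; exact: measurable_on_unit_interval.
  - exists `|B|; split; first by rewrite num_real.
    move=> y By w _ /=; have [x01|x01] := boolP (0 <= X w <= 1).
      rewrite on_unit_intervalE//; apply: le_trans (hB _ x01) _.
      exact: le_trans (ler_norm B) (ltW By).
    by rewrite on_unit_interval_out// normr0; exact: le_trans (ltW By).
have m1 : measurable_fun setT (EFin \o (u \o X)) by exact/measurable_EFinP/mX.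
apply/integrableP; split => //.
have /integrableP[m2 +] := i1.
congr (_ < _)%E; apply: ae_eq_integral => //; try exact: measurableT_comp.
by apply: filterS (ae_on u) => w h _; rewrite h.
Qed.

Lemma expectE (Y : T -> R) : expect P Y = \int[P]_w Y w.
Proof. by rewrite /expect unlock. Qed.

Lemma expect_le u v : measurable_fun setT u -> measurable_fun setT v ->
  bounded01 u -> bounded01 v -> (forall x, 0 <= x <= 1 -> u x <= v x) ->
  expect P (fun w => u (X w)) <= expect P (fun w => v (X w)).
Proof.
move=> mu mv bu bv uv; rewrite !expectE.
have E a : measurable_fun setT a -> \int[P]_w a (X w) =
    \int[P]_w on_unit_interval a (X w).
  move=> ma; rewrite /Rintegral; congr fine; apply: ae_eq_integral => //.
  - exact/measurable_EFinP/mX.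
  - by apply/measurable_EFinP/mX; exact: measurable_on_unit_interval.
  - exact: ae_on.
have B01 a : bounded01 a -> bounded01 (on_unit_interval a).
  by move=> [B hB]; exists B => x x01; rewrite on_unit_intervalE// hB.
rewrite (E u)// (E v)//; apply: le_Rintegral => //.
- by apply: integrable_bounded01; [exact: measurable_on_unit_interval|exact: B01].
- by apply: integrable_bounded01; [exact: measurable_on_unit_interval|exact: B01].
move=> w _; have [x01|x01] := boolP (0 <= X w <= 1).
  by rewrite !on_unit_intervalE// uv.
by rewrite !on_unit_interval_out.
Qed.

Lemma expect_cst (k : R) : expect P (fun _ => k) = k.
Proof.
by rewrite /expect (expectation_cst P k).
Qed.

Lemma expect_lin (k1 k2 : R) u v : measurable_fun setT u -> measurable_fun setT v ->
  bounded01 u -> bounded01 v ->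
  expect P (fun w => k1 * u (X w) + k2 * v (X w)) =
  k1 * expect P (fun w => u (X w)) + k2 * expect P (fun w => v (X w)).
Proof.
move=> mu mv bu bv; rewrite !expectE.
have iu := integrable_bounded01 mu bu; have iv := integrable_bounded01 mv bv.
rewrite RintegralD// ?RintegralZl//.
- exact: (integrableZl measurableT k1 iu).
- exact: (integrableZl measurableT k2 iv).
Qed.

Lemma bounded01_lin (k1 k2 : R) u v : bounded01 u -> bounded01 v ->
  bounded01 (fun x => k1 * u x + k2 * v x).
Proof.
move=> [Bu hu] [Bv hv]; exists (`|k1| * Bu + `|k2| * Bv) => x x01.
apply: le_trans (ler_normD _ _) _; rewrite !normrM.
by apply: lerD; apply: ler_wpM2l => //; [exact: hu|exact: hv].
Qed.

(** A uniform approximation of h by a linear combination passes to the means. *)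
Lemma expect_approx (k1 k2 K : R) h u v :
  measurable_fun setT h -> measurable_fun setT u -> measurable_fun setT v ->
  bounded01 h -> bounded01 u -> bounded01 v ->
  (forall x, 0 <= x <= 1 -> `|h x - (k1 * u x + k2 * v x)| <= K) ->
  `|expect P (fun w => h (X w)) -
    (k1 * expect P (fun w => u (X w)) + k2 * expect P (fun w => v (X w)))| <= K.
Proof.
move=> mh mu mv bh bu bv hK.
pose l x := k1 * u x + k2 * v x.
have ml : measurable_fun setT l.
  by apply: measurable_funD; apply: measurable_funM.
have bl : bounded01 l by exact: bounded01_lin.
rewrite -expect_lin//.
have b1 : bounded01 (fun _ => 1) by exists 1 => x _; rewrite normr1.
have m1 : measurable_fun setT (fun _ : R => 1 : R) by exact: measurable_cst.
have up s : expect P (fun w => 1 * l (X w) + s * 1) = expect P (fun w => l (X w)) + s.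
  by rewrite (@expect_lin 1 s l (fun _ => 1))// expect_cst mul1r mulr1.
have ms s : measurable_fun setT (fun x => 1 * l x + s * 1).
  by apply: measurable_funD; apply: measurable_funM.
rewrite ler_distl -[_ - K]up -up; apply/andP; split.
- apply: (expect_le (ms (- K)) mh (bounded01_lin 1 (- K) bl b1) bh) => x /hK.
  by rewrite ler_distl -/(l x) mul1r mulr1 => /andP[].
- apply: (expect_le mh (ms K) bh (bounded01_lin 1 K bl b1)) => x /hK.
  by rewrite ler_distl -/(l x) mul1r mulr1 => /andP[].
Qed.

End means.

(** * Conditional means of adjacency statistics *)

Section three_points.
Context d (T : measurableType d) (R : realType) (P : probability T R).
Variables (X1 X2 X3 : {RV P >-> R}) (g : R -> R).
Hypothesis indep : forall A B C : set R, measurable A -> measurable B ->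
  measurable C ->
  (P ((X1 @^-1` A) `&` (X2 @^-1` B) `&` (X3 @^-1` C)) =
  P (X1 @^-1` A) * P (X2 @^-1` B) * P (X3 @^-1` C))%E.
Hypothesis X1g : has_density X1 (on_unit_interval g).
Hypothesis X2g : has_density X2 (on_unit_interval g).
Hypothesis X3g : has_density X3 (on_unit_interval g).
Hypothesis g_ge0 : forall x, 0 <= g x.
Hypothesis mg : measurable_fun setT g.

(** The law of X is first regarded as a measure on [measurableTypeR R], the
    Borel structure that carries Lebesgue measure: its display differs from
    that of the law. *)
Lemma integral_distribution_density (X : {RV P >-> R}) (F : R -> \bar R) :
  has_density X (on_unit_interval g) ->
  measurable_fun setT F -> (forall y, 0 <= F y)%E ->
  (\int[distribution P X]_y F y =
   \int[@lebesgue_measure R]_(y in `[0%R, 1%R]) ((g y)%:E * F y))%E.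
Proof.
move=> Xg mF F0.
have mX : measurable_fun setT (X : T -> measurableTypeR R).
  by move=> mT B mB; exact: (measurable_funPT X mT B mB).
transitivity (\int[@pushforward _ _ T (measurableTypeR R) R P X]_y F y)%E.
  by rewrite ge0_integral_distribution// ge0_integral_pushforward.
rewrite (@integral_density _ _ R _ (@lebesgue_measure R) (on_unit_interval g))//.
- rewrite [RHS]integral_mkcond; apply: eq_integral => y _.
  rewrite patchE /on_unit_interval indicE; case: (y \in _); rewrite ?mulr1//.
  by rewrite mulr0 mul0e.
- exact: measurable_on_unit_interval.
- by move=> x; rewrite mulr_ge0.
Qed.

Section bounded_statistic.
Variable phi : R * (R * R) -> R.
Hypothesis mphi : measurable_fun setT phi.
Hypothesis phi0 : forall z, 0 <= phi z.
Hypothesis phi1 : forall z, phi z <= 1.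

Let H : R -> \bar R := cond_mean X2 X3 (EFin \o phi).
Let h (x : R) : R := fine (H x).

Let mphiE : measurable_fun setT (EFin \o phi).
Proof. exact/measurable_EFinP. Qed.

Let phi0E z : (0 <= (EFin \o phi) z)%E. Proof. by rewrite /= lee_fin. Qed.

Let H01 x : (0 <= H x <= 1)%E.
Proof.
rewrite /H cond_mean_ge0//=; apply: cond_mean_le1 => // z.
by rewrite phi0E /= lee_fin.
Qed.

Let hE x : (h x)%:E = H x.
Proof.
case/andP: (H01 x) => H0 H1; rewrite fineK// ge0_fin_numE//.
by rewrite (le_lt_trans H1)// ltry.
Qed.

Let mh : measurable_fun setT h.
Proof.
apply/measurable_EFinP; rewrite (_ : EFin \o h = H).
  exact: measurable_cond_mean.
by apply/funext => x /=; rewrite hE.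
Qed.

Let bh : bounded01 h.
Proof.
exists 1 => x _; rewrite ler_norml.
have := H01 x; rewrite -hE !lee_fin => /andP[h0 ->]; rewrite andbT.
by rewrite (le_trans _ h0)// oppr_le0.
Qed.

Let phi_preimage (B : set R) : measurable B ->
  (\int[P]_(w in X1 @^-1` B) (phi (X1 w, (X2 w, X3 w)))%:E =
   \int[P]_(w in X1 @^-1` B) (h (X1 w))%:E)%E.
Proof.
move=> mB; under [RHS]eq_integral do rewrite hE.
exact: (integral_cond_mean_preimage indep mphiE phi0E mB).
Qed.

(** A uniform estimate of the conditional mean bounds every version of the
    conditional expectation. *)
Lemma cond_exp_approx (q : R -> R) (K : R) (Z : T -> R) :
  (forall x, 0 <= x <= 1 -> approx_within (H x) (q x) K) ->
  is_cond_exp X1 (fun w => phi (X1 w, (X2 w, X3 w))) Z ->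
  {ae P, forall w, `|Z w - q (X1 w)| <= K}.
Proof.
move=> hK /cond_exp_ae_unique/(_ mh) Zh.
have {}Zh := Zh (integrable_bounded01 X1g mh bh) phi_preimage.
apply: filterS2 Zh (ae_unit_interval X1g) => w -> x01.
by rewrite -approx_withinE hE; exact: hK.
Qed.

Lemma expect_phi_approx (q u v : R -> R) (k1 k2 K : R) :
  (forall x, 0 <= x <= 1 -> approx_within (H x) (q x) K) ->
  (forall x, 0 <= x <= 1 -> q x = k1 * u x + k2 * v x) ->
  measurable_fun setT u -> measurable_fun setT v -> bounded01 u -> bounded01 v ->
  `|expect P (fun w => phi (X1 w, (X2 w, X3 w))) -
    (k1 * expect P (fun w => u (X1 w)) + k2 * expect P (fun w => v (X1 w)))| <= K.
Proof.
move=> hK hq mu mv bu bv.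
have -> : expect P (fun w => phi (X1 w, (X2 w, X3 w))) = expect P (fun w => h (X1 w)).
  rewrite !expectE /Rintegral; congr fine.
  have := phi_preimage measurableT; by rewrite preimage_setT.
apply: (expect_approx X1g) => // x x01.
by rewrite -hq// -approx_withinE hE; exact: hK.
Qed.

End bounded_statistic.

Section adjacency_means.
Variable r : R.

(** The adjacency indicators of a triple (x1, (x2, x3)). *)
Definition phi12 (z : R * (R * R)) : R := adj r z.1 z.2.1.
Definition phi13 (z : R * (R * R)) : R := adj r z.1 z.2.2.
Definition phi23 (z : R * (R * R)) : R := adj r z.2.1 z.2.2.

Lemma measurable_phi12 : measurable_fun setT phi12.
Proof.
apply: (@measurableT_comp _ _ _ _ _ _ (fun z : R * R => adj r z.1 z.2) _
  (fun z : R * (R * R) => (z.1, z.2.1))); first exact: measurable_adj.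
apply: measurable_fun_pair => //.
exact: measurableT_comp measurable_fst measurable_snd.
Qed.

Lemma measurable_phi13 : measurable_fun setT phi13.
Proof.
apply: (@measurableT_comp _ _ _ _ _ _ (fun z : R * R => adj r z.1 z.2) _
  (fun z : R * (R * R) => (z.1, z.2.2))); first exact: measurable_adj.
apply: measurable_fun_pair => //.
exact: measurableT_comp measurable_snd measurable_snd.
Qed.

Lemma measurable_phi23 : measurable_fun setT phi23.
Proof.
apply: (@measurableT_comp _ _ _ _ _ _ (fun z : R * R => adj r z.1 z.2) _
  (fun z : R * (R * R) => z.2)); first exact: measurable_adj.
exact: measurable_snd.
Qed.

Let adjE_ge0 x y : (0 <= (adj r x y)%:E)%E.
Proof. by rewrite lee_fin adj_ge0. Qed.

Let madj x : measurable_fun setT (fun y => (adj r x y)%:E).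
Proof.
apply/measurable_EFinP.
by have := measurable_fun_pair2 x (measurable_adj r).
Qed.

Let int2 (F : R -> \bar R) := @integral_distribution_density X2 F X2g.
Let int3 (F : R -> \bar R) := @integral_distribution_density X3 F X3g.

Lemma cond_mean12 x : cond_mean X2 X3 (EFin \o phi12) x = edge2 g r x.
Proof.
rewrite /cond_mean /edge2 -int2//; apply: eq_integral => y _ /=.
rewrite /phi12 /= integral_cst// -[RHS]mule1; congr (_ * _)%E.
exact: probability_setT.
Qed.

Lemma cond_mean1213 x :
  cond_mean X2 X3 (EFin \o (fun z => phi12 z * phi13 z)) x =
  (edge2 g r x * edge2 g r x)%E.
Proof.
rewrite /cond_mean.
under eq_integral => y _.
  under eq_integral do rewrite /phi12 /phi13 /= EFinM.
  rewrite ge0_integralZl//= int3// -/(edge2 g r x).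
  over.
rewrite ge0_integralZr//; first by rewrite int2.
apply: integral_ge0 => y _; rewrite mule_ge0 ?lee_fin//.
Qed.

Let madj_l z : measurable_fun setT (fun y => (adj r y z)%:E).
Proof.
apply/measurable_EFinP.
by have := measurable_fun_pair1 z (measurable_adj r).
Qed.

Let mgE : measurable_fun setT (EFin \o g).
Proof. exact/measurable_EFinP. Qed.

Lemma measurable_edge2 : measurable_fun setT (edge2 g r).
Proof.
apply: (@measurable_integral_param R _ _
  (fun z : R * R => (g z.2)%:E * (adj r z.1 z.2)%:E)%E).
- apply: emeasurable_funM; apply/measurable_EFinP; last exact: measurable_adj.
  exact: measurableT_comp mg measurable_snd.
- by move=> z; rewrite mule_ge0 ?lee_fin.
- exact: measurable_itv.
Qed.

Lemma cond_mean1223 x :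
  cond_mean X2 X3 (EFin \o (fun z => phi12 z * phi23 z)) x = path2 g r x.
Proof.
rewrite /cond_mean /path2 -int2.
- apply: eq_integral => y _.
  under eq_integral do rewrite /phi12 /phi23 /= EFinM.
  by rewrite ge0_integralZl//= int3.
- by apply: emeasurable_funM => //; exact: measurable_edge2.
- move=> y; rewrite mule_ge0//; apply: integral_ge0 => z _.
  by rewrite mule_ge0 ?lee_fin.
Qed.

Lemma cond_mean121323 x :
  cond_mean X2 X3 (EFin \o (fun z => phi12 z * phi13 z * phi23 z)) x =
  triangle g r x.
Proof.
rewrite /cond_mean /triangle -int2.
- apply: eq_integral => y _.
  under eq_integral do rewrite /phi12 /phi13 /phi23 /= -mulrA EFinM EFinM.
  rewrite ge0_integralZl//=.
  + rewrite int3//; first exact: emeasurable_funM.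
    by move=> z; rewrite mule_ge0.
  + exact: emeasurable_funM.
  + by move=> z _; rewrite mule_ge0.
- apply: emeasurable_funM => //.
  apply: (@measurable_integral_param R _ _
    (fun z : R * R => (g z.2)%:E * ((adj r x z.2)%:E * (adj r z.1 z.2)%:E))%E).
  + apply: emeasurable_funM; first exact: measurableT_comp mgE measurable_snd.
    apply: emeasurable_funM; first exact: measurableT_comp (madj x) measurable_snd.
    by apply/measurable_EFinP; exact: measurable_adj.
  + by move=> z; rewrite !mule_ge0 ?lee_fin.
  + exact: measurable_itv.
- move=> y; rewrite mule_ge0//; apply: integral_ge0 => z _.
  by rewrite !mule_ge0 ?lee_fin.
Qed.

End adjacency_means.

End three_points.

(** * The ratio of two expansions *)

(** Here U, V and S stand for the three means.  The two smallness conditions on r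
    give 4 + r ^ 2 b >= 3 and e1 >= 2 m r ^ 2, hence a denominator at least
    6 m r ^ 2, while the numerator is at most 12 C r ^ 6. *)
Lemma ratio_approx (R : realFieldType) (e1 e2 S U V r C D m : R) :
  0 < r -> r <= 1 -> 0 < m -> m <= S -> `|U| <= D -> `|V| <= D -> 0 <= C ->
  D * r ^+ 2 <= m / 2 -> C * r ^+ 4 <= m ->
  `|e1 - (4 * r ^+ 2 * S + 4 * r ^+ 4 / 3 * V)| <= C * r ^+ 6 ->
  `|e2 - (3 * r ^+ 2 * S + 5 * r ^+ 4 / 12 * U)| <= C * r ^+ 6 ->
  `|e2 / e1 - (3 + r ^+ 2 * ((5 * U) / (12 * S))) /
              (4 + r ^+ 2 * ((4 * V) / (3 * S)))| <= 2 * C / m * r ^+ 3.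
Proof.
move=> r0 r1 m0 mS hU hV C0 hD hC h1 h2.
have S0 : 0 < S by exact: lt_le_trans mS.
have x0 : 0 < r ^+ 2 by rewrite exprn_gt0.
set a := (5 * U) / (12 * S); set b := (4 * V) / (3 * S).
have small w : `|w| <= D -> r ^+ 2 * `|w| <= m / 2.
  by move=> hw; rewrite mulrC (le_trans _ hD)// ler_wpM2r// ltW.
have frac (x k1 k2 w : R) : 0 <= x -> 0 < k1 -> 0 < k2 -> k1 <= 2 * k2 ->
    x * `|w| <= m / 2 -> `|x * ((k1 * w) / (k2 * S))| <= 1.
  move=> x0' k10 k20 k12 hw.
  have kS : 0 < k2 * S by rewrite mulr_gt0.
  rewrite mulrA normf_div (ger0_norm (ltW kS)) ler_pdivrMr// mul1r mulrCA.
  rewrite !normrM (ger0_norm x0') (ger0_norm (ltW k10)).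
  apply: le_trans (ler_wpM2l (ltW k10) hw) _.
  apply: le_trans (_ : 2 * k2 * (m / 2) <= _).
    by rewrite ler_wpM2r// divr_ge0// ltW.
  rewrite (_ : 2 * k2 * (m / 2) = k2 * m); last by field.
  by rewrite ler_wpM2l// ltW.
have ha : `|r ^+ 2 * a| <= 1.
  by apply: frac; [exact: ltW|lra|lra|lra|exact: small].
have hb : `|r ^+ 2 * b| <= 1.
  by apply: frac; [exact: ltW|lra|lra|lra|exact: small].
have E1 : 4 * r ^+ 2 * S + 4 * r ^+ 4 / 3 * V = r ^+ 2 * S * (4 + r ^+ 2 * b).
  by rewrite /b; field; rewrite gt_eqF.
have E2 : 3 * r ^+ 2 * S + 5 * r ^+ 4 / 12 * U = r ^+ 2 * S * (3 + r ^+ 2 * a).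
  by rewrite /a; field; rewrite gt_eqF.
move: h1 h2; rewrite E1 E2 => h1 h2.
move: (r ^+ 2 * a) (r ^+ 2 * b) ha hb h1 h2 => A B {E1 E2} ha hb h1 h2.
set d1 := e1 - _ in h1; set d2 := e2 - _ in h2.
have hB : 3 <= 4 + B by move: hb; rewrite ler_norml; lra.
have e1_ge : 2 * (r ^+ 2 * m) <= e1.
  have : C * r ^+ 6 <= r ^+ 2 * m.
    rewrite (_ : C * r ^+ 6 = r ^+ 2 * (C * r ^+ 4)); last by ring.
    by rewrite ler_wpM2l// ltW.
  have : r ^+ 2 * m <= r ^+ 2 * S by rewrite ler_wpM2l// ltW.
  have : r ^+ 2 * S * 3 <= r ^+ 2 * S * (4 + B).
    by rewrite ler_wpM2l// mulr_ge0 ?ltW.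
  have e1E : e1 = r ^+ 2 * S * (4 + B) + d1 by rewrite /d1; ring.
  move: h1; rewrite {}e1E ler_norml; move: (r ^+ 2 * m) (r ^+ 2 * S * (4 + B)).
  by move: (r ^+ 2 * S) (C * r ^+ 6) => ? ? ? ? /andP[]; lra.
have e1_gt0 : 0 < e1 by rewrite (lt_le_trans _ e1_ge)// !mulr_gt0.
have B_gt0 : 0 < 4 + B by lra.
have num : `|d2 * (4 + B) - d1 * (3 + A)| <= 12 * (C * r ^+ 6).
  apply: le_trans (ler_normB _ _) _; rewrite !normrM.
  have CR : 0 <= C * r ^+ 6 by rewrite mulr_ge0// exprn_ge0 ?ltW.
  have : `|d2| * `|4 + B| <= C * r ^+ 6 * 5.
    by apply: ler_pM => //; move: hb; rewrite !ler_norml; lra.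
  have : `|d1| * `|3 + A| <= C * r ^+ 6 * 5.
    by apply: ler_pM => //; move: ha; rewrite !ler_norml; lra.
  by move: CR; move: (C * r ^+ 6) (`|d2| * _) (`|d1| * _) => ? ? ?; lra.
rewrite (_ : _ - _ = (d2 * (4 + B) - d1 * (3 + A)) / (e1 * (4 + B))); last first.
  by rewrite /d1 /d2; field; rewrite !gt_eqF.
rewrite normf_div [X in _ / X]ger0_norm; last by rewrite mulr_ge0 ?ltW.
rewrite ler_pdivrMr; last by rewrite mulr_gt0.
apply: le_trans num _.
have : 2 * (r ^+ 2 * m) * 3 <= e1 * (4 + B).
  by apply: ler_pM => //; rewrite mulr_ge0// ltW// mulr_gt0.
have K0 : 0 <= 2 * C / m * r ^+ 3.
  by apply: mulr_ge0; [apply: divr_ge0; [exact: mulr_ge0|exact: ltW]|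
                       rewrite exprn_ge0// ltW].
move=> /(ler_wpM2l K0); apply: le_trans.
rewrite (_ : 2 * C / m * r ^+ 3 * (2 * (r ^+ 2 * m) * 3) = 12 * (C * r ^+ 5));
  last by field; rewrite gt_eqF.
have r5 : 0 <= r ^+ 5 by rewrite exprn_ge0// ltW.
by rewrite ler_wpM2l// ler_wpM2l// exprS ler_piMl.
Qed.

(** * Independence, boundedness and the expansions of the graph *)

(** The product rule for three of the variables: the other sets are full. *)
Lemma mutually_independent3 (d : measure_display) (T : measurableType d)
    (R : realType) (P : probability T R) (n : nat) (X : 'I_n -> {RV P >-> R})
    (i j k : 'I_n) :
  mutually_independent X -> i != j -> i != k -> j != k ->
  forall A B C : set R, measurable A -> measurable B -> measurable C ->
  (P ((X i @^-1` A) `&` (X j @^-1` B) `&` (X k @^-1` C)) =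
   P (X i @^-1` A) * P (X j @^-1` B) * P (X k @^-1` C))%E.
Proof.
move=> indep ij ik jk A B C mA mB mC.
pose F l := if l == i then A else if l == j then B else if l == k then C
  else setT.
have mF l : measurable (F l) by rewrite /F; do 3 case: ifP => // _.
have Fi : F i = A by rewrite /F eqxx.
have Fj : F j = B by rewrite /F eq_sym (negbTE ij) eqxx.
have Fk : F k = C.
  by rewrite /F eq_sym (negbTE ik) eq_sym (negbTE jk) eqxx.
have := indep F mF.
rewrite (bigD1 i)//= (bigD1 j) 1?eq_sym//= (bigD1 k)/=; last first.
  by rewrite eq_sym ik eq_sym jk.
rewrite big1 ?mule1; last first.
  move=> l /andP[/andP[li lj] lk].
  by rewrite /F (negbTE li) (negbTE lj) (negbTE lk) preimage_setT probability_setT.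
rewrite Fi Fj Fk muleA => <-; congr (P _).
apply/seteqP; split => [w [[wi wj] wk] l _|w h] /=.
  rewrite /F; case: eqVneq => [->//|_]; case: eqVneq => [->//|_].
  by case: eqVneq => [->//|_].
by split; [split|]; [have := h i Logic.I|have := h j Logic.I|have := h k Logic.I];
  rewrite /= ?Fi ?Fj ?Fk.
Qed.

Lemma rgg_adjE (R : realType) (n : nat) (r : R) (x : 'I_n -> R) (i j : 'I_n) :
  i != j -> rgg_adj r x i j = adj r (x i) (x j).
Proof. by move=> ij; rewrite mxE ij /adj /=; case: (_ <= _). Qed.

Section bounds.
Context (R : realType) (g : R -> R).
Hypothesis gsm : bounded_fourth_derivative g.
Local Notation f := (on_unit_interval g).

Lemma bounded01_mul (u v : R -> R) : bounded01 u -> bounded01 v ->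
  bounded01 (fun x => u x * v x).
Proof.
move=> [Bu hu] [Bv hv]; exists (Bu * Bv) => x x01.
by rewrite normrM ler_pM ?hu ?hv.
Qed.

Lemma bounded01_derive1n k : (k < 4)%N -> bounded01 (derive1n k g).
Proof.
by move=> k4; have [B _ hB] := derive1n_bounded gsm; exists B => x; exact: hB.
Qed.

Lemma bounded01_on_unit_interval : bounded01 f.
Proof.
have [B hB] := @bounded01_derive1n 0 isT.
by exists B => x x01; rewrite on_unit_intervalE// hB.
Qed.

End bounds.

Theorem proposition2p2 (R : realType) (g : R -> R)
    (g_periodic : periodic g 1)
    (g_away : exists2 c : R, 0 < c & forall x, c <= g x)
    (g_smooth : bounded_fourth_derivative g)
    (f_density : is_density (on_unit_interval g))
    (r : nat -> R) (r_pos : forall n, 0 < r n) (r_half : forall n, r n <= 2^-1)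
    (r_to0 : r @ \oo --> (0 : R))
    (d : nat -> measure_display) (T : forall n, measurableType (d n))
    (P : forall n, probability (T n) R)
    (X : forall n, 'I_n -> {RV (P n) >-> R})
    (X_density : forall n (i : 'I_n), has_density (X n i) (on_unit_interval g))
    (X_indep : forall n, mutually_independent (X n)) :
  let f := on_unit_interval g in
  let f' := g^`() in
  let f'' := g^`(2) in
  let A n (w : T n) : 'M[R]_n := rgg_adj (r n) (fun i => X n i w) in
  let A12 n (hn : (2 < n)%N) (w : T n) : R := A n w (vtx1 hn) (vtx2 hn) in
  let A13 n (hn : (2 < n)%N) (w : T n) : R := A n w (vtx1 hn) (vtx3 hn) in
  let A23 n (hn : (2 < n)%N) (w : T n) : R := A n w (vtx2 hn) (vtx3 hn) in
  let X1 n (hn : (2 < n)%N) : {RV (P n) >-> R} := X n (vtx1 hn) in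
  let E n (hn : (2 < n)%N) (h : R -> R) : R :=
    expect (P n) (fun w => h (X1 n hn w)) in
  let Ef2 n hn : R := E n hn (fun x => f x ^+ 2) in
  let Eff'' n hn : R := E n hn (fun x => f x * f'' x) in
  let Ef'2ff'' n hn : R := E n hn (fun x => f' x ^+ 2 + 2 * (f x * f'' x)) in
  let E1213 n (hn : (2 < n)%N) : R :=
    expect (P n) (fun w => A12 n hn w * A13 n hn w) in
  let E121323 n (hn : (2 < n)%N) : R :=
    expect (P n) (fun w => A12 n hn w * A13 n hn w * A23 n hn w) in
  let mu n (hn : (2 < n)%N) : R := E121323 n hn / E1213 n hn in
  let a_f n hn : R := (5 * Ef'2ff'' n hn) / (12 * Ef2 n hn) in
  let b_f n hn : R := (4 * Eff'' n hn) / (3 * Ef2 n hn) in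
  [/\ (exists C : R, forall n (hn : (2 < n)%N) (Z : T n -> R),
         is_cond_exp (X1 n hn) (A12 n hn) Z ->
         {ae P n, forall w, let x := X1 n hn w in
           `|Z w - (2 * r n * f x + f'' x / 3 * r n ^+ 3)| <= C * r n ^+ 5}),
      (exists C : R, forall n (hn : (2 < n)%N) (Z : T n -> R),
         is_cond_exp (X1 n hn) (fun w => A12 n hn w * A13 n hn w) Z ->
         {ae P n, forall w, let x := X1 n hn w in
           `|Z w - (4 * r n ^+ 2 * f x ^+ 2
                    + 4 * r n ^+ 4 / 3 * f x * f'' x)| <= C * r n ^+ 6}),
      (exists C : R, forall n (hn : (2 < n)%N) (Z : T n -> R),
         is_cond_exp (X1 n hn) (fun w => A12 n hn w * A23 n hn w) Z ->
         {ae P n, forall w, let x := X1 n hn w in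
           `|Z w - (4 * r n ^+ 2 * f x ^+ 2
                    + r n ^+ 4 / 3 * (4 * f' x ^+ 2 + 6 * f x * f'' x))|
           <= C * r n ^+ 6}),
      (exists C : R, forall n (hn : (2 < n)%N) (Z : T n -> R),
         is_cond_exp (X1 n hn)
           (fun w => A12 n hn w * A13 n hn w * A23 n hn w) Z ->
         {ae P n, forall w, let x := X1 n hn w in
           `|Z w - (3 * r n ^+ 2 * f x ^+ 2
                    + 5 * r n ^+ 4 / 12 * (f' x ^+ 2 + 2 * f x * f'' x))|
           <= C * r n ^+ 5}) &
      [/\ (exists C : R, forall n (hn : (2 < n)%N),
             `|E1213 n hn - (4 * r n ^+ 2 * Ef2 n hn
                             + 4 * r n ^+ 4 / 3 * Eff'' n hn)|
             <= C * r n ^+ 5),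
          (exists C : R, forall n (hn : (2 < n)%N),
             `|E121323 n hn - (3 * r n ^+ 2 * Ef2 n hn
                               + 5 * r n ^+ 4 / 12 * Ef'2ff'' n hn)|
             <= C * r n ^+ 6) &
          (exists C : R, forall n (hn : (2 < n)%N),
             `|mu n hn - (3 + r n ^+ 2 * a_f n hn) / (4 + r n ^+ 2 * b_f n hn)|
             <= C * r n ^+ 3)]].
Proof.
move=> f f' f'' A A12 A13 A23 X1 E Ef2 Eff'' Ef'2ff'' E1213 E121323 mu a_f b_f.
have [c c0 g_ge] := g_away.
have g_ge0 x : 0 <= g x by rewrite (le_trans _ (g_ge x))// ltW.
have mg : measurable_fun setT g by exact: (measurable_derive1n g_smooth (k := 0)).
have mf : measurable_fun setT f by exact: measurable_on_unit_interval.
have mf' : measurable_fun setT f' by exact: (measurable_derive1n g_smooth (k := 1)).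
have mf'' : measurable_fun setT f'' by exact: (measurable_derive1n g_smooth (k := 2)).
have bf : bounded01 f by exact: bounded01_on_unit_interval.
have bf' : bounded01 f' by exact: (bounded01_derive1n g_smooth (k := 1)).
have bf'' : bounded01 f'' by exact: (bounded01_derive1n g_smooth (k := 2)).
have fE x : 0 <= x <= 1 -> f x = g x by exact: on_unit_intervalE.
have [C C0 hC] := conditional_expansions g_periodic g_ge0 g_smooth.
pose X2 n (hn : (2 < n)%N) : {RV (P n) >-> R} := X n (vtx2 hn).
pose X3 n (hn : (2 < n)%N) : {RV (P n) >-> R} := X n (vtx3 hn).
have indep n hn := mutually_independent3 (X_indep n)
  (isT : vtx1 hn != vtx2 hn) (isT : vtx1 hn != vtx3 hn) (isT : vtx2 hn != vtx3 hn).
pose XY n hn w := (X1 n hn w, (X2 n hn w, X3 n hn w)).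
have A12E n hn w : A12 n hn w = phi12 (r n) (XY n hn w) by exact: rgg_adjE.
have A13E n hn w : A13 n hn w = phi13 (r n) (XY n hn w) by exact: rgg_adjE.
have A23E n hn w : A23 n hn w = phi23 (r n) (XY n hn w) by exact: rgg_adjE.
have Y2E n hn : (fun w => A12 n hn w * A13 n hn w) =
    (fun w => phi12 (r n) (XY n hn w) * phi13 (r n) (XY n hn w)).
  by apply/funext => w; rewrite A12E A13E.
have Y3E n hn : (fun w => A12 n hn w * A23 n hn w) =
    (fun w => phi12 (r n) (XY n hn w) * phi23 (r n) (XY n hn w)).
  by apply/funext => w; rewrite A12E A23E.
have Y4E n hn : (fun w => A12 n hn w * A13 n hn w * A23 n hn w) =
    (fun w => phi12 (r n) (XY n hn w) * phi13 (r n) (XY n hn w) *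
              phi23 (r n) (XY n hn w)).
  by apply/funext => w; rewrite A12E A13E A23E.
have adj01 (s x y : R) : 0 <= adj s x y <= 1 by rewrite adj_ge0 adj_le1.
have mul01 (a b : R) : 0 <= a <= 1 -> 0 <= b <= 1 -> 0 <= a * b <= 1.
  by move=> /andP[a0 a1] /andP[b0 b1]; rewrite mulr_ge0//= mulr_ile1.
(* The statistics A12, A12 A13, A12 A23, A12 A13 A23 as functions of the points,
   and their conditional means. *)
pose s1 n := phi12 (r n).
pose s2 n z := phi12 (r n) z * phi13 (r n) z.
pose s3 n z := phi12 (r n) z * phi23 (r n) z.
pose s4 n z := phi12 (r n) z * phi13 (r n) z * phi23 (r n) z.
have s1_01 n z : 0 <= s1 n z <= 1 by exact: adj01.
have s2_01 n z : 0 <= s2 n z <= 1 by apply: mul01; exact: adj01.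
have s3_01 n z : 0 <= s3 n z <= 1 by apply: mul01; exact: adj01.
have s4_01 n z : 0 <= s4 n z <= 1.
  by apply: mul01; [exact: s2_01|exact: adj01].
have ms1 n : measurable_fun setT (s1 n) by exact: measurable_phi12.
have ms2 n : measurable_fun setT (s2 n).
  by apply: measurable_funM; [exact: measurable_phi12|exact: measurable_phi13].
have ms3 n : measurable_fun setT (s3 n).
  by apply: measurable_funM; [exact: measurable_phi12|exact: measurable_phi23].
have ms4 n : measurable_fun setT (s4 n).
  by apply: measurable_funM; [exact: ms2|exact: measurable_phi23].
have ge0 (a b : R) (h : 0 <= a <= b) : 0 <= a by case/andP: h.
have le1 (a b : R) (h : 0 <= a <= b) : a <= b by case/andP: h.
have q1 n hn x : 0 <= x <= 1 -> approx_within
    (cond_mean (X2 n hn) (X3 n hn) (EFin \o s1 n) x)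
    (2 * r n * f x + f'' x / 3 * r n ^+ 3) (C * r n ^+ 5).
  move=> x01; rewrite fE// (cond_mean12 _ (X_density n _) g_ge0 mg).
  by case: (hC (r n) x (r_pos n) (r_half n) x01).
have q2 n hn x : 0 <= x <= 1 -> approx_within
    (cond_mean (X2 n hn) (X3 n hn) (EFin \o s2 n) x)
    (4 * r n ^+ 2 * f x ^+ 2 + 4 * r n ^+ 4 / 3 * f x * f'' x) (C * r n ^+ 6).
  move=> x01; rewrite fE// (cond_mean1213 (X_density n _) (X_density n _) g_ge0 mg).
  by case: (hC (r n) x (r_pos n) (r_half n) x01).
have q3 n hn x : 0 <= x <= 1 -> approx_within
    (cond_mean (X2 n hn) (X3 n hn) (EFin \o s3 n) x)
    (4 * r n ^+ 2 * f x ^+ 2 + r n ^+ 4 / 3 * (4 * f' x ^+ 2 + 6 * f x * f'' x))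
    (C * r n ^+ 6).
  move=> x01; rewrite fE// (cond_mean1223 (X_density n _) (X_density n _) g_ge0 mg).
  by case: (hC (r n) x (r_pos n) (r_half n) x01).
have q4 n hn x : 0 <= x <= 1 -> approx_within
    (cond_mean (X2 n hn) (X3 n hn) (EFin \o s4 n) x)
    (3 * r n ^+ 2 * f x ^+ 2 + 5 * r n ^+ 4 / 12 * (f' x ^+ 2 + 2 * f x * f'' x))
    (C * r n ^+ 6).
  move=> x01; rewrite fE// (cond_mean121323 (X_density n _) (X_density n _) g_ge0 mg).
  by case: (hC (r n) x (r_pos n) (r_half n) x01).
have r65 n : C * r n ^+ 6 <= C * r n ^+ 5.
  rewrite ler_wpM2l// exprS ler_piMl//; first by rewrite exprn_ge0// ltW.
  by rewrite (le_trans (r_half n))// invf_le1//; lra.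
have ce n hn (s : R * (R * R) -> R) q K Z (ms : measurable_fun setT s)
    (s01 : forall z, 0 <= s z <= 1) :=
  @cond_exp_approx _ _ _ _ (X1 n hn) (X2 n hn) (X3 n hn) g (indep n hn)
    (X_density n _) s ms (fun z => ge0 _ _ (s01 z)) (fun z => le1 _ _ (s01 z)) q K Z.
have ee n hn (s : R * (R * R) -> R) q u v k1 k2 K (ms : measurable_fun setT s)
    (s01 : forall z, 0 <= s z <= 1) :=
  @expect_phi_approx _ _ _ _ (X1 n hn) (X2 n hn) (X3 n hn) g (indep n hn)
    (X_density n _) s ms (fun z => ge0 _ _ (s01 z)) (fun z => le1 _ _ (s01 z))
    q u v k1 k2 K.
have bmul u v : bounded01 u -> bounded01 v -> bounded01 (fun x : R => u x * v x).
  exact: bounded01_mul.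
have mu2 : measurable_fun setT (fun x => f x ^+ 2) by exact: measurable_funX.
have muv : measurable_fun setT (fun x => f x * f'' x) by exact: measurable_funM.
have mw : measurable_fun setT (fun x => f' x ^+ 2 + 2 * (f x * f'' x)).
  apply: measurable_funD; first exact: measurable_funX.
  by apply: measurable_funM => //; exact: measurable_cst.
have bu2 : bounded01 (fun x => f x ^+ 2) by exact: (bmul f f).
have buv : bounded01 (fun x => f x * f'' x) by exact: bmul.
have bw : bounded01 (fun x => f' x ^+ 2 + 2 * (f x * f'' x)).
  have := bounded01_lin 1 2 (bmul f' f' bf' bf') buv.
  by move=> [B hB]; exists B => x /hB; rewrite mul1r expr2.
have h2 n hn : `|E1213 n hn - (4 * r n ^+ 2 * Ef2 n hn + 4 * r n ^+ 4 / 3 * Eff'' n hn)|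
    <= C * r n ^+ 6.
  rewrite /E1213 Y2E; apply: (ee n hn (s2 n) _ _ _ _ _ _ (ms2 n) (s2_01 n)
    (q2 n hn)) => //.
  by move=> x _; rewrite !mulrA.
have h4 n hn : `|E121323 n hn - (3 * r n ^+ 2 * Ef2 n hn + 5 * r n ^+ 4 / 12 * Ef'2ff'' n hn)|
    <= C * r n ^+ 6.
  rewrite /E121323 Y4E; apply: (ee n hn (s4 n) _ _ _ _ _ _ (ms4 n) (s4_01 n)
    (q4 n hn)) => //.
  by move=> x _; rewrite !mulrA.
split.
- exists C => n hn Z; rewrite (_ : A12 n hn = (fun w => s1 n (XY n hn w))).
    exact: (ce n hn (s1 n) _ _ _ (ms1 n) (s1_01 n) (q1 n hn)).
  by apply/funext => w; rewrite A12E.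
- exists C => n hn Z; rewrite Y2E.
  exact: (ce n hn (s2 n) _ _ _ (ms2 n) (s2_01 n) (q2 n hn)).
- exists C => n hn Z; rewrite Y3E.
  exact: (ce n hn (s3 n) _ _ _ (ms3 n) (s3_01 n) (q3 n hn)).
- exists C => n hn Z; rewrite Y4E => hZ.
  have := ce n hn (s4 n) _ _ _ (ms4 n) (s4_01 n) (q4 n hn) hZ.
  by apply: filterS => w hw; apply: le_trans hw (r65 n).
split.
- by exists C => n hn; apply: le_trans (h2 n hn) (r65 n).
- by exists C => n hn; exact: h4.
(* The mean of f ^ 2 is at least c ^ 2, and the two other means are bounded,
   uniformly in n. *)
have S_ge n hn : c ^+ 2 <= Ef2 n hn.
  rewrite -(expect_cst (P n) (c ^+ 2)).
  apply: (expect_le (X_density n (vtx1 hn)) (u := fun=> c ^+ 2)) => //.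
  - by exists (c ^+ 2) => x _; rewrite ger0_norm// exprn_ge0// ltW.
  - by move=> x x01; rewrite fE// lerXn2r// nnegrE// ltW.
have mean_bound (u : R -> R) : measurable_fun setT u -> bounded01 u ->
    exists2 D : R, 0 <= D & forall n hn, `|E n hn u| <= D.
  move=> mu' [B hB]; have hB0 : 0 <= B.
    by rewrite (le_trans _ (hB 0 _))// lexx ler01.
  exists B => // n hn; rewrite ler_norml.
  rewrite -[- B](expect_cst (P n)) -[X in _ && (_ <= X)](expect_cst (P n)).
  apply/andP; split.
  - apply: (expect_le (X_density n (vtx1 hn)) (u := fun=> - B) (v := u)) => //.
    + by exists B => x _; rewrite normrN ger0_norm.
    + by exists B.
    + by move=> x /hB; rewrite ler_norml => /andP[].
  - apply: (expect_le (X_density n (vtx1 hn)) (u := u) (v := fun=> B)) => //.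
    + by exists B.
    + by exists B => x _; rewrite ger0_norm.
    + by move=> x /hB; rewrite ler_norml => /andP[].
have [D1 D10 hD1] := mean_bound _ mw bw.
have [D2 D20 hD2] := mean_bound _ muv buv.
pose D := D1 + D2; pose m := c ^+ 2.
have m0 : 0 < m by rewrite exprn_gt0.
have D0 : 0 <= D by rewrite addr_ge0.
have rho0 : 0 < m / 2 / (C + D + 1).
  by rewrite !divr_gt0// ltr_pwDr// addr_ge0.
have [N _ hN] : \forall n \near \oo, r n < m / 2 / (C + D + 1).
  have /cvgrPdist_lt /(_ _ rho0) := r_to0; apply: filterS => n.
  by rewrite sub0r normrN ger0_norm// ltW.
(* Beyond N the radius satisfies both smallness conditions of the ratio. *)
have large n hn : (N <= n)%N ->
    `|mu n hn - (3 + r n ^+ 2 * a_f n hn) / (4 + r n ^+ 2 * b_f n hn)|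
    <= 2 * C / m * r n ^+ 3.
  move=> Nn; have r1 : r n <= 1 by rewrite (le_trans (r_half n))// invf_le1//; lra.
  have rn0 := ltW (r_pos n).
  have hr : (C + D + 1) * r n <= m / 2.
    by rewrite mulrC -ler_pdivlMr ?(ltW (hN n Nn))// ltr_pwDr// addr_ge0.
  have CD : C * r n + D * r n + r n <= m / 2 by rewrite -{3}[r n]mul1r -!mulrDl.
  have Cr : 0 <= C * r n by exact: mulr_ge0.
  have Dr : 0 <= D * r n by exact: mulr_ge0.
  apply: (ratio_approx (S := Ef2 n hn) (D := D)) => //.
  - by rewrite (le_trans (hD1 n hn))// lerDl.
  - by rewrite (le_trans (hD2 n hn))// lerDr.
  - apply: le_trans (_ : D * r n <= _); last lra.
    by rewrite expr2 ler_wpM2l// ler_piMl.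
  - apply: le_trans (_ : C * r n <= _); last lra.
    by rewrite ler_wpM2l// exprS ler_piMr// exprn_ile1.
(* The denominator 4 + r ^ 2 b may vanish for the remaining finitely many n; each
   of them contributes its own constant. *)
have each n : exists2 K : R, 0 <= K & forall hn,
    `|mu n hn - (3 + r n ^+ 2 * a_f n hn) / (4 + r n ^+ 2 * b_f n hn)| <= K.
  have [hn|n2] : (2 < n)%N \/ ~ (2 < n)%N by case: (2 < n)%N; [left|right].
    exists `|mu n hn - (3 + r n ^+ 2 * a_f n hn) / (4 + r n ^+ 2 * b_f n hn)| => //.
    by move=> hn'; rewrite (bool_irrelevance hn' hn).
  by exists 0 => // hn; case: (n2 hn).
have [K hK] := choice (fun n => let: ex_intro2 K K0 h := each n in
  ex_intro (fun K => 0 <= K /\ _) K (conj K0 h)).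
have K0 n : 0 <= K n by case: (hK n).
have r3 n : 0 < r n ^+ 3 by rewrite exprn_gt0.
have S0 : 0 <= \sum_(i < N) K i / r i ^+ 3.
  by apply: sumr_ge0 => i _; rewrite divr_ge0// ltW.
have CM : 0 <= 2 * C / m by rewrite divr_ge0 ?mulr_ge0// ltW.
exists (2 * C / m + \sum_(i < N) K i / r i ^+ 3) => n hn.
have [Nn|nN] := leqP N n.
  apply: le_trans (large n hn Nn) _; rewrite ler_wpM2r ?lerDl//.
  exact: ltW.
apply: le_trans ((hK n).2 hn) _.
rewrite -ler_pdivrMr// (bigD1 (Ordinal nN))//= addrCA lerDl addr_ge0//.
by apply: sumr_ge0 => i _; rewrite divr_ge0// ltW.
Qed.
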